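(* There is a constant $C>0$ such that, if $u(\mathbf{x}_1,\mathbf{x}_2,\mathbf{x}_3,t)$, with $\mathbf{x}_1,\mathbf{x}_2,\mathbf{x}_3\in\mathbb{R}^3$, solves $$ i\frac{\partial}{\partial t}u=-\triangle u+|x|^2u\ \text{ in }\mathbb{R}^{9+1},\qquad u(x,0)=f(x)\in L^2(\mathbb{R}^9),\qquad x=(\mathbf{x}_1,\mathbf{x}_2,\mathbf{x}_3)\in\mathbb{R}^9, $$ then $$ \int_0^{2\pi}\int_{\mathbb{R}^3}|u(\mathbf{x},\mathbf{x},\mathbf{x},t)|^2\,d\mathbf{x}\,dt\leq C\,\|(-\triangle+|x|^2)f\|_2^2 . $$
   Context: $\triangle$ is the Laplacian on $\mathbb{R}^9$ and $\|\cdot\|_2$ is the norm of $L^2(\mathbb{R}^9)$. The solution is $u(\cdot,t)=e^{-it(-\triangle+|x|^2)}f$, given by the expansion of $f$ in the orthonormal basis of Hermite functions (eigenfunctions of $-\triangle+|x|^2$ with eigenvalues $2|\alpha|+9$, $\alpha$ a $9$-multiindex). The expression $u(\mathbf{x},\mathbf{x},\mathbf{x},t)$ is the restriction of $u(\cdot,t)$ to the diagonal $\mathbf{x}_1=\mathbf{x}_2=\mathbf{x}_3=\mathbf{x}\in\mathbb{R}^3$. *)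

(* Defs.v *)
From HB Require Import structures.
From mathcomp Require Import all_boot all_order all_algebra complex.
From mathcomp Require Import all_classical all_reals all_analysis.

Set Implicit Arguments.
Unset Strict Implicit.
Unset Printing Implicit Defensive.
Import Order.TTheory GRing.Theory Num.Theory numFieldNormedType.Exports.
Local Open Scope classical_set_scope.
Local Open Scope complex_scope.
Local Open Scope ring_scope.

(* R^3 is R * R * R and R^9 is R^3 * R^3 * R^3, both with
   the product sigma-algebra, product Lebesgue measure and product topology;
   a point of R^9 is literally a triple (x1, x2, x3) of points of R^3. *)
Definition R3 (R : realType) : Type := (R * R * R)%type.
Definition R9 (R : realType) : Type := (R3 R * R3 R * R3 R)%type.

(* The canonical sigma-finite structure on a product measure is only available
   in the library for subprobabilities. *)
Lemma product_measure1_sigma_finite (d1 d2 : measure_display)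
    (T1 : measurableType d1) (T2 : measurableType d2) (R : realType)
    (m1 : {sigma_finite_measure set T1 -> \bar R})
    (m2 : {sigma_finite_measure set T2 -> \bar R}) :
  sigma_finite setT (m1 \x m2)%E.
Proof.
have /sigma_finiteP[F [TF ndF Foo]] := sigma_finiteT m1.
have /sigma_finiteP[G [TG ndG Goo]] := sigma_finiteT m2.
exists (fun n => F n `*` G n).
  rewrite -setXTT TF TG predeqE => -[x y]; split.
    move=> [/= [n _ Fnx] [k _ Gky]]; exists (maxn n k) => //; split.
    - by move: x Fnx; exact/subsetPset/ndF/leq_maxl.
    - by move: y Gky; exact/subsetPset/ndG/leq_maxr.
  by move=> [n _ []/= ? ?]; split; exists n.
move=> k; have [? ?] := Foo k; have [? ?] := Goo k.
split; first exact: measurableX.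
by rewrite product_measure1E// lte_mul_pinfty// ge0_fin_numE.
Qed.

Definition mu2 (R : realType) := (@lebesgue_measure R \x @lebesgue_measure R)%E.
Arguments mu2 R : clear implicits.
HB.instance Definition _ (R : realType) := Measure.on (mu2 R).
HB.instance Definition _ (R : realType) :=
  Measure_isSigmaFinite.Build _ _ _ (mu2 R)
    (product_measure1_sigma_finite lebesgue_measure lebesgue_measure).

Definition mu3 (R : realType) := (mu2 R \x @lebesgue_measure R)%E.
Arguments mu3 R : clear implicits.
HB.instance Definition _ (R : realType) := Measure.on (mu3 R).
HB.instance Definition _ (R : realType) :=
  Measure_isSigmaFinite.Build _ _ _ (mu3 R)
    (product_measure1_sigma_finite (mu2 R) lebesgue_measure).

Definition mu6 (R : realType) := (mu3 R \x mu3 R)%E.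
Arguments mu6 R : clear implicits.
HB.instance Definition _ (R : realType) := Measure.on (mu6 R).
HB.instance Definition _ (R : realType) :=
  Measure_isSigmaFinite.Build _ _ _ (mu6 R)
    (product_measure1_sigma_finite (mu3 R) (mu3 R)).

Definition mu9 (R : realType) := (mu6 R \x mu3 R)%E.
Arguments mu9 R : clear implicits.
HB.instance Definition _ (R : realType) := Measure.on (mu9 R).
HB.instance Definition _ (R : realType) :=
  Measure_isSigmaFinite.Build _ _ _ (mu9 R)
    (product_measure1_sigma_finite (mu6 R) (mu3 R)).

(* Built on measurableTypeR, the domain of lebesgue_measure, so that they are
   the domains of mu3 and mu9; the sigma-algebra inferred from R * R * R is
   the same but has another display. *)
Definition meas3 (R : realType) :=
  [the measurableType _ of
     (measurableTypeR R * measurableTypeR R * measurableTypeR R)%type].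
Definition meas9 (R : realType) :=
  [the measurableType _ of (meas3 R * meas3 R * meas3 R)%type].
Definition meas_spacetime (R : realType) :=
  [the measurableType _ of (measurableTypeR R * meas3 R)%type].

Definition proj3 (T : Type) (x : T * T * T) (i : 'I_3) : T :=
  match val i with 0%N => x.1.1 | 1%N => x.1.2 | _ => x.2 end.

Definition mk3 (T : Type) (f : 'I_3 -> T) : T * T * T :=
  (f (inord 0), f (inord 1), f (inord 2)).

(* The 9 coordinates are indexed by pairs (i, j): the j-th coordinate of the
   i-th point of R^3. *)
Definition idx9 : finType := ('I_3 * 'I_3)%type.

Definition coord9 (R : realType) (x : R9 R) (p : idx9) : R :=
  proj3 (proj3 x p.1) p.2.

Definition basis9 (R : realType) (p : idx9) : R9 R :=
  mk3 (fun i => mk3 (fun j => ((i, j) == p)%:R)).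

Definition sqnorm9 (R : realType) (x : R9 R) : R := \sum_p coord9 x p ^+ 2.

Definition diag9 (R : realType) (x : R3 R) : R9 R := (x, x, x).

Definition sqmod (R : realType) (z : R[i]) : R :=
  complex.Re z ^+ 2 + complex.Im z ^+ 2.

Definition measurable_complex (d : measure_display) (T : measurableType d)
    (R : realType) (f : T -> R[i]) : Prop :=
  measurable_fun setT (fun x => complex.Re (f x)) /\
  measurable_fun setT (fun x => complex.Im (f x)).

Definition sqnormL2 (R : realType) (f : R9 R -> R[i]) : \bar R :=
  (\int[mu9 R]_x (sqmod (f x))%:E)%E.

Definition inL2 (R : realType) (f : R9 R -> R[i]) : Prop :=
  measurable_complex (T := meas9 R) f /\ (sqnormL2 f < +oo)%E.

Definition pairing (R : realType) (f : R9 R -> R[i]) (phi : R9 R -> R) : R[i] :=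
  (Rintegral (mu9 R) setT (fun x => complex.Re (f x) * phi x)) +i*
  (Rintegral (mu9 R) setT (fun x => complex.Im (f x) * phi x)).

(* Physicists' Hermite polynomials: H_(n+1) = 2 X H_n - H_n', equivalently
   H_n(x) = (-1)^n e^(x^2) (d/dx)^n e^(-x^2). *)
Fixpoint hermite_poly (R : realType) (n : nat) : {poly R} :=
  if n is m.+1 then
    2%:R *: ('X * hermite_poly R m) - (hermite_poly R m)^`()
  else 1.

(* H_n e^(-x^2/2) has L^2(R)-norm (2^n n! sqrt pi)^(1/2). *)
Definition hermite_fun (R : realType) (n : nat) (x : R) : R :=
  (Num.sqrt (2 ^+ n * n`!%:R * Num.sqrt pi))^-1 *
  (hermite_poly R n).[x] * expR (- (x ^+ 2 / 2)).

Definition multiindex : Type := idx9 -> nat.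

Definition deg (a : multiindex) : nat := (\sum_p a p)%N.

Definition hermite9 (R : realType) (a : multiindex) (x : R9 R) : R :=
  \prod_p hermite_fun (a p) (coord9 x p).

Definition hermite_coef (R : realType) (f : R9 R -> R[i]) (a : multiindex) :
    R[i] :=
  pairing f (hermite9 a).

Definition eigenvalue9 (R : realType) (a : multiindex) : R :=
  (2 * deg a + 9)%N%:R.

Definition expNi (R : realType) (s : R) : R[i] := cos s -i* sin s.

(* Every component of a multiindex of degree at most N is at most N, whence the
   enumeration by maps into 'I_N.+1. *)
Definition sum_deg_le (R : realType) (N : nat) (F : multiindex -> R[i]) :
    R[i] :=
  \sum_(a : {ffun idx9 -> 'I_N.+1} | (deg (fun p => a p) <= N)%N)
     F (fun p => a p).

Definition hermite_sum (R : realType) (N : nat) (f : R9 R -> R[i]) (x : R9 R) :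
    R[i] :=
  sum_deg_le N (fun a => hermite_coef f a * (hermite9 a x)%:C).

(* Partial sums of the expansion of e^(-itH) f, H = - Laplacian + |x|^2. *)
Definition evolution_sum (R : realType) (N : nat) (f : R9 R -> R[i]) (t : R)
    (x : R9 R) : R[i] :=
  sum_deg_le N (fun a =>
    expNi (t * eigenvalue9 R a) * hermite_coef f a * (hermite9 a x)%:C).

(* u(., t) = e^(-itH) f for every t: the expansion converges to u(., t) in
   L^2(R^9). At t = 0 this is the initial condition, as the Hermite functions
   are an orthonormal basis. *)
Definition schrodinger_solution (R : realType) (f : R9 R -> R[i])
    (u : R -> R9 R -> R[i]) : Prop :=
  forall t : R, inL2 (u t) /\
    (fun N => sqnormL2 (fun x => u t x - evolution_sum N f t x)) @ \oo
      --> (0%:E : \bar R).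

Definition laplacian (R : realType) (phi : R9 R -> R) (x : R9 R) : R :=
  \sum_p 'D_(basis9 R p) ('D_(basis9 R p) phi) x.

Definition hermite_op (R : realType) (phi : R9 R -> R) (x : R9 R) : R :=
  - laplacian phi x + sqnorm9 x * phi x.

Definition iter_partial (R : realType) (l : seq idx9) (phi : R9 R -> R) :
    R9 R -> R :=
  foldr (fun p psi => 'D_(basis9 R p) psi) phi l.

(* Real Schwartz functions on R^9. Boundedness of the partial derivatives of
   the next order makes each iterated partial derivative Lipschitz, so that
   phi is smooth. *)
Definition schwartz (R : realType) (phi : R9 R -> R) : Prop :=
  forall l : seq idx9,
    (forall (p : idx9) (x : R9 R),
       derivable (iter_partial l phi) x (basis9 R p)) /\
    (forall k : nat, exists M : R, forall x : R9 R,
       (1 + sqnorm9 x) ^+ k * `|iter_partial l phi x| <= M).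

(* g = (- Laplacian + |x|^2) f in the sense of tempered distributions, for f
   and g in L^2(R^9). *)
Definition weak_hermite_op (R : realType) (f g : R9 R -> R[i]) : Prop :=
  forall phi : R9 R -> R, schwartz phi ->
    pairing f (hermite_op phi) = pairing g phi.

Definition sqnorm_spacetime (R : realType) (v : R -> R3 R -> R[i]) : \bar R :=
  (\int[@lebesgue_measure R]_(t in `[0%R, (2 * pi)%R]%classic)
     \int[mu3 R]_x (sqmod (v t x))%:E)%E.

(* v(x, t) = u(x, x, x, t). The diagonal is a null set of R^9, so the
   restriction of u(., t), an L^2 class, is defined through its Hermite
   expansion: the partial sums are continuous functions, and v is the limit of
   their restrictions to the diagonal in L^2([0, 2 pi] x R^3). *)
Definition diagonal_restriction (R : realType) (u : R -> R9 R -> R[i])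
    (v : R -> R3 R -> R[i]) : Prop :=
  measurable_complex (T := meas_spacetime R) (fun q : R * R3 R => v q.1 q.2) /\
  (fun N => sqnorm_spacetime
     (fun t x => hermite_sum N (u t) (diag9 x) - v t x)) @ \oo
    --> (0%:E : \bar R).

(* Main.v *)
(* On the eigenspace of degree k the time evolution is a scalar of modulus 1, and the frequencies
   2 k + 9 are distinct integers, so the space-time norm over [0, 2 pi] is the sum over k of the
   norms of the diagonal restrictions of the eigenspace components.  It suffices to bound the
   restriction on the k-th eigenspace by C (k + 1) in operator norm: (k + 1)^2 is absorbed by the
   squared eigenvalue, and Bessel's inequality for (- Laplacian + |x|^2) f concludes.

   For the restriction T on the k-th eigenspace, T T^* has kernel
   sum_(|a| = k) h_a(x,x,x) h_a(y,y,y), the coefficient of r^k in a product of nine Mehler kernels,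
   three for each coordinate of R^3.  The cube of the one-dimensional Mehler kernel at (x, y) is
   (1 - r^2)^(-1) times that at (sqrt 3 x, sqrt 3 y), so T T^* is diagonal in the Hermite functions
   of sqrt 3 x with eigenvalues proportional to coefficients of (1 - r^2)^(-3), which are at most
   (k + 1)^2. *)
Require Import Defs.
From mathcomp Require Import all_boot all_order all_algebra complex.
From mathcomp Require Import all_classical all_reals all_analysis.
From mathcomp Require Import measurable_realfun ring lra zify.
Import Order.TTheory GRing.Theory Num.Theory numFieldNormedType.Exports.
Set Implicit Arguments.
Unset Strict Implicit.
Unset Printing Implicit Defensive.
Local Open Scope ring_scope.

(** * Mehler's kernel as a formal power series *)

(** Series in [r] are polynomials modulo [X^(N+1)], with congruence expressed as divisibility, so
    neither convergence in [r] nor the exponential form of Mehler's kernel enters: the cube identity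
    is compared through logarithmic derivatives, which are rational in [r]. The dilation by [sqrt 3]
    is forced by the Gaussian, since three copies of [e^(-x^2/2)] on the diagonal make
    [e^(-(sqrt 3 x)^2/2)].

    The functions [h_a(x,x,x)] with [|a| = k] are not orthogonal. Estimating them one by one would
    bound the operator by the trace of [T T^*], which grows like [k^5]; only the diagonalisation
    gives the order [k^2] that the squared eigenvalue can absorb.

    The diagonal being a null set, the restriction itself has to be constructed. The slice estimate,
    summed over [m <= k < n], makes the restricted partial sums Cauchy in space-time with an
    explicit tail as rate.

    Complex functions are split into real and imaginary parts, so that [e^(-i t (2k+9))] appears as
    a cosine and a sine, each of squared norm [pi] over the period. *)

Section TruncatedSeries.
Variable K : numFieldType.
Implicit Types (p q D : {poly K}) (N : nat).

Lemma dvdXnP N p :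
  reflect (forall i, (i < N)%N -> p`_i = 0) ('X^N %| p).
Proof.
apply: (iffP idP) => [/dvdpP[q ->] i iN|p0]; first by rewrite coefMXn iN.
rewrite -(poly_take_drop N p) dvdp_addl ?dvdp_mulIr//.
suff -> : take_poly N p = 0 by exact: dvdp0.
by apply/polyP => i; rewrite coef_take_poly coef0; case: ifP => // /p0.
Qed.

(** As [(1 - X^2)^2] has constant term 1, the coefficient of [X^i] in the equation is
    [(i+1) D_(i+1)] plus terms in [D_0, ..., D_i], so in characteristic 0 the coefficients vanish
    one after another. Differentiation lowers degrees, whence the gain from [N] to [N+1]. *)
Lemma ode_unique N q D : D`_0 = 0 ->
  'X^N %| ((1 - 'X^2) ^+ 2 * D^`() - q * D) -> 'X^(N.+1) %| D.
Proof.
move=> D0 ode; apply/dvdXnP => i; elim/ltn_ind: i => -[//|i] IH iN.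
have Dle k : (k <= i)%N -> D`_k = 0.
  by move=> ki; apply: IH => //; apply: ltn_trans iN; rewrite ltnS.
have /dvdXnP/(_ i iN) := ode.
rewrite coefB [(q * D)`_i]coefM big1 ?subr0; last first.
  by move=> j _; rewrite Dle ?mulr0// leq_subr.
rewrite coefM big_ord_recl /= subn0 big1 ?addr0; last first.
  by move=> j _; rewrite coef_deriv Dle ?mul0rn ?mulr0//= /bump /= add1n ltn_subrL /=
    (leq_ltn_trans _ (ltn_ord j)).
rewrite coef_deriv expr2 coef0M coefB coef1 coefXn subr0 mulr1 mul1r.
by move/eqP; rewrite mulrn_eq0 => /eqP.
Qed.

(** Reads a sum over multiindices of given degree as one coefficient of a product of generating
    functions; the bound [N] on the entries is the truncation of each factor. *)
Lemma coef_prod_poly (I : finType) (w : I -> nat -> K) N k :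
  (\prod_p \poly_(i < N.+1) w p i)`_k =
  \sum_(f : {ffun I -> 'I_N.+1} | (\sum_p f p == k)%N) \prod_p w p (f p).
Proof.
under eq_bigr do rewrite poly_def.
rewrite bigA_distr_bigA coef_sum [RHS]big_mkcond; apply: eq_bigr => f _.
under eq_bigr do rewrite -mul_polyC.
rewrite big_split/= -rmorph_prod -expr_sum coefCM coefXn eq_sym.
by case: ifP => _; rewrite ?mulr1 ?mulr0.
Qed.

(** The inverse of [1 - X^2] modulo [X^(N+1)]. *)
Definition geom2 N : {poly K} := \poly_(i < N.+1) (~~ odd i)%:R.

Lemma geom2P N : 'X^(N.+1) %| (1 - 'X^2) * geom2 N - 1.
Proof.
apply/dvdXnP => i iN; rewrite mulrBl mul1r !coefB coefXnM coef1 !coef_poly iN.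
case: i iN => [|[|i]] iN /=; rewrite ?subr0 ?subrr//.
by rewrite !subSS subn0 (ltn_trans (ltnSn _) (ltn_trans (ltnSn _) iN)) negbK subrr.
Qed.

Lemma coef_geom2 N i : 0 <= (geom2 N)`_i <= 1.
Proof. by rewrite coef_poly; case: ifP => // _; rewrite ?lexx ?ler01//; case: odd;
  rewrite /= ?lexx ler01. Qed.

(** A product with [geom2] sums [j+1] coefficients with weights in [[0, 1]] and so costs one factor
    [j+1]; the cube takes two such products. *)
Lemma coef_geom2_cube N i : 0 <= (geom2 N ^+ 3)`_i <= (i.+1%:R) ^+ 2.
Proof.
have step (p : {poly K}) m : (forall j, 0 <= p`_j <= (j.+1%:R) ^+ m) ->
    forall j, 0 <= (p * geom2 N)`_j <= (j.+1%:R) ^+ m.+1.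
  move=> pm j; rewrite coefM; apply/andP; split.
    apply: sumr_ge0 => k _; apply: mulr_ge0; [by case/andP: (pm k)|].
    by case/andP: (coef_geom2 N (j - k)).
  have -> : (j.+1%:R ^+ m.+1 : K) = \sum_(k < j.+1) j.+1%:R ^+ m.
    by rewrite sumr_const card_ord exprS mulr_natl.
  apply: ler_sum => k _; case/andP: (pm k) => p0 p1.
  case/andP: (coef_geom2 N (j - k)) => g0 g1.
  rewrite -[leRHS]mulr1; apply: ler_pM => //; apply: (le_trans p1).
  by apply: lerXn2r; rewrite ?nnegrE ?ler0n// ler_nat.
have e1 : forall j, 0 <= (geom2 N)`_j <= (j.+1%:R) ^+ 0.
  by move=> j; rewrite expr0 coef_geom2.
by rewrite exprSr expr2; apply: (step _ 1%N); apply: (step _ 0%N).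
Qed.

End TruncatedSeries.

(** * Mehler's differential equation and the cube of Mehler's kernel *)

Section HermiteKernel.
Variable R : realType.
Implicit Types (x y s : R) (n N : nat).
Let H n := hermite_poly R n.

Lemma hermiteS n : H n.+1 = 2%:R *: ('X * H n) - (H n)^`().
Proof. by []. Qed.

(** The lowering relation. It removes the derivative from the definition of the Hermite polynomials
    and so yields the three-term recursion. *)
Lemma deriv_hermite n : (H n.+1)^`() = (2 * n.+1)%N%:R *: H n.
Proof.
elim: n => [|n IH].
  by rewrite /H /= derivB derivZ derivM derivX derivC mulr0 addr0 mul1r deriv0 subr0.
rewrite hermiteS derivB derivZ derivM derivX mul1r {2}IH derivZ IH.
rewrite -!mul_polyC !natrM !polyCM.
have -> : (H n)^`() = 2%:R *: ('X * H n) - H n.+1 by rewrite hermiteS opprB addrC subrK.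
rewrite -mul_polyC -(natr1 n.+1) -(natr1 n) !polyCD !polyC1; ring.
Qed.

Lemma hermite_rec n x :
  (H n.+2).[x] = 2%:R * x * (H n.+1).[x] - (2 * n.+1)%N%:R * (H n).[x].
Proof. by rewrite hermiteS deriv_hermite !(hornerD, hornerN, hornerZ, hornerM, hornerX);
  ring. Qed.

Lemma hermite1 x : (H 1).[x] = 2%:R * x.
Proof. by rewrite /H /= derivC subr0 mulr1 !hornerE. Qed.

(** The coefficient of [r^n] in Mehler's kernel: the product of two normalised Hermite functions
    without its Gaussians and without [1 / sqrt pi], which [gauss_weight] restores later. *)
Definition mehler_coef x y n : R :=
  (H n).[x] * (H n).[y] / (2 ^+ n * n`!%:R).

Let w := mehler_coef.

Lemma mehler_coef0 x y : w x y 0 = 1.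
Proof. by rewrite /w /mehler_coef /H /= !hornerC expr0 fact0 !mulr1 invr1 mulr1. Qed.

Lemma mehler_coef1 x y : w x y 1 = 2%:R * x * y.
Proof. rewrite /w /mehler_coef !hermite1 expr1 factS fact0; by field. Qed.

Lemma mehler_coef2 x y :
  2%:R * w x y 2 = (1 - 2%:R * (x ^+ 2 + y ^+ 2)) * w x y 0 + 2%:R * x * y * w x y 1.
Proof.
rewrite /w /mehler_coef !hermite_rec !hermite1 /H /= !hornerC !factS fact0; by field.
Qed.

Lemma mehler_coef3 x y :
  3%:R * w x y 3 = (3%:R - 2%:R * (x ^+ 2 + y ^+ 2)) * w x y 1
    + 2%:R * x * y * (w x y 2 + w x y 0).
Proof.
rewrite /w /mehler_coef !hermite_rec !hermite1 /H /= !hornerC !factS fact0; by field.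
Qed.

(** The coefficient of [r^(n+3)] in Mehler's differential equation. The three-term recursion in [x]
    and in [y] reduces it to a rational identity in the values of [H_(n+1)] and [H_n] at both
    points. The lemmas [mehler_coef1] to [mehler_coef3] are the degrees 0 to 2, where some indices
    would be negative. *)
Lemma mehler_rec x y n :
  n.+4%:R * w x y n.+4 = ((2 * n.+2 + 1)%N%:R - 2%:R * (x ^+ 2 + y ^+ 2)) * w x y n.+2
    - n.+1%:R * w x y n + 2%:R * x * y * (w x y n.+3 + w x y n.+1).
Proof.
rewrite /w /mehler_coef !hermite_rec.
move: (H n.+1).[x] (H n.+1).[y] (H n).[x] (H n).[y] => a b c d.
rewrite !factS !natrM.
have f0 : (n`!%:R : R) != 0 by rewrite pnatr_eq0 -lt0n fact_gt0.
have n1 : (n.+1%:R : R) != 0 by rewrite pnatr_eq0.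
have n2 : (n.+2%:R : R) != 0 by rewrite pnatr_eq0.
have n3 : (n.+3%:R : R) != 0 by rewrite pnatr_eq0.
have n4 : (n.+4%:R : R) != 0 by rewrite pnatr_eq0.
have e0 : (2 ^+ n : R) != 0 by rewrite expf_neq0 ?pnatr_eq0.
rewrite !exprS !natrD !natrM.
move: n1 n2 n3 n4; rewrite -(natr1 n.+3) -(natr1 n.+2) -(natr1 n.+1) -(natr1 n).
move: f0 e0; move: (n`!%:R) (2 ^+ n) (n%:R : R) => f e m f0 e0 n1 n2 n3 n4.
field.
rewrite f0 e0 /=.
by rewrite n1 n2 n3 n4.
Qed.

Definition mehler_poly N x y : {poly R} := \poly_(i < N.+1) w x y i.

(* The logarithmic derivative in r of Mehler's kernel
   (1 - r^2)^(-1/2) exp((2 x y r - (x^2 + y^2) r^2) / (1 - r^2)), times (1 - r^2)^2. *)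
Definition mehler_rate x y : {poly R} :=
  'X - 'X^3 + (2%:R * x * y)%:P * (1 + 'X^2)
    - (2%:R * (x ^+ 2 + y ^+ 2))%:P * 'X.

Lemma mehler_ode N x y : 'X^N %|
  (1 - 'X^2) ^+ 2 * (mehler_poly N x y)^`() - mehler_rate x y * mehler_poly N x y.
Proof.
apply/dvdXnP => i iN; set P := mehler_poly N x y.
have PE j : (j <= N)%N -> P`_j = w x y j by move=> jN; rewrite coef_poly ltnS jN.
have -> : (1 - 'X^2) ^+ 2 * P^`() - mehler_rate x y * P =
    P^`() - 2%:R%:P * ('X^2 * P^`()) + 'X^4 * P^`() - ('X * P - 'X^3 * P
    + (2%:R * x * y)%:P * (P + 'X^2 * P)
    - (2%:R * (x ^+ 2 + y ^+ 2))%:P * ('X * P)) :> {poly R}.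
  rewrite /mehler_rate; ring.
have dE j : (P^`())`_j = j.+1%:R * P`_j.+1 by rewrite coef_deriv mulr_natl.
rewrite !(coefD, coefN, coefCM, coefXnM, coefXM, dE) {dE}.
have P_le j k : (j <= k)%N -> (k < N)%N -> P`_j = w x y j.
  by move=> jk kN; rewrite PE// (leq_trans jk)// ltnW.
(* In degrees 0 to 3 the term [X^4 P'] contributes nothing. Degree 3 is still the recursion at
   [n = 0], whose term [n w_n] is 0. *)
case: i iN => [|[|[|[|i]]]] iN /=; rewrite ?subSS ?subn0 /=.
- rewrite !PE// mehler_coef0 mehler_coef1; ring.
- rewrite (PE 2)// !(P_le _ _ _ iN)//; have := mehler_coef2 x y; lra.
- rewrite (PE 3)// !(P_le _ _ _ iN)//; have := mehler_coef3 x y; lra.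
- rewrite (PE 4)// !(P_le _ _ _ iN)//; have := mehler_rec x y 0; lra.
rewrite (PE i.+1.+4)// !(P_le _ _ _ iN); [|lia..]; have := mehler_rec x y i.+1.
rewrite !(natrD, natrM); lra.
Qed.

Definition sqrt3 : R := Num.sqrt 3%:R.

(* Both sides solve the same differential equation modulo X^N. *)
Lemma mehler_cube N x y : 'X^(N.+1) %|
  (1 - 'X^2) * mehler_poly N x y ^+ 3 - mehler_poly N (sqrt3 * x) (sqrt3 * y).
Proof.
set P := mehler_poly N x y; set Z := mehler_poly _ (_ * _) _.
apply: (@ode_unique _ _ (mehler_rate (sqrt3 * x) (sqrt3 * y))).
  rewrite -horner_coef0 hornerD hornerN hornerM hornerD hornerN hornerXn hornerC.
  rewrite horner_exp !horner_coef0 !coef_poly /= !mehler_coef0; ring.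
(* The right-hand side is [(1 - X^2)^2] times the logarithmic derivative of [(1 - X^2) P^3]: the
   factor [1 - X^2] brings the power [-3/2] of the cube back to [-1/2]. *)
have rate3 : mehler_rate (sqrt3 * x) (sqrt3 * y)
    = 3%:R * mehler_rate x y - 2%:R * 'X * (1 - 'X^2).
  have s2 : sqrt3 ^+ 2 = 3%:R by rewrite sqr_sqrtr// ler0n.
  rewrite /mehler_rate; have -> : 2%:R * (sqrt3 * x) * (sqrt3 * y) = 3%:R * (2%:R * x * y).
    by rewrite -s2; ring.
  have -> : 2%:R * ((sqrt3 * x) ^+ 2 + (sqrt3 * y) ^+ 2) = 3%:R * (2%:R * (x ^+ 2 + y ^+ 2)).
    by rewrite -s2; ring.
  have C3 a : (3%:R * a)%:P = 3%:R * a%:P :> {poly R} by rewrite polyCM polyC_natr.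
  rewrite !C3; ring.
have deriv_cube (Q : {poly R}) : (Q ^+ 3)^`() = 3%:R * Q ^+ 2 * Q^`().
  by rewrite !exprS expr0 !derivM derivC; ring.
have -> : (1 - 'X^2) ^+ 2 * ((1 - 'X^2) * P ^+ 3 - Z)^`()
    - mehler_rate (sqrt3 * x) (sqrt3 * y) * ((1 - 'X^2) * P ^+ 3 - Z) =
  3%:R * (1 - 'X^2) * P ^+ 2 * ((1 - 'X^2) ^+ 2 * P^`() - mehler_rate x y * P)
  - ((1 - 'X^2) ^+ 2 * Z^`() - mehler_rate (sqrt3 * x) (sqrt3 * y) * Z) :> {poly R}.
  rewrite rate3 derivB derivM derivB derivXn derivC /= (deriv_cube P); ring.
by rewrite dvdp_sub// ?dvdp_mull// mehler_ode.
Qed.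

(** The coefficient of [r^(k - |b|)] in [(1 - r^2)^(-3)], and 0 if [|b| > k]. The sum has at most
    one term; this is the shape in which the Cauchy product delivers it. *)
Definition kernel_weight N k (b : {ffun 'I_3 -> 'I_N.+1}) : R :=
  \sum_(j < k.+1 | (\sum_i b i == k - j)%N) (geom2 R N ^+ 3)`_j.

Lemma kernel_weight_bounds N k (b : {ffun 'I_3 -> 'I_N.+1}) :
  0 <= kernel_weight k b <= k.+1%:R ^+ 2.
Proof.
rewrite /kernel_weight; have [bk|bk] := leqP (\sum_i b i)%N k; last first.
  rewrite big1 ?lexx ?exprn_ge0// => j /eqP bE.
  by move: bk; rewrite bE ltnNge leq_subr.
pose j0 := inord (k - \sum_i b i)%N : 'I_k.+1.
rewrite (big_pred1 j0); last first.
  have j0E : j0 = (k - \sum_i b i)%N :> nat by rewrite inordK// ltnS leq_subr.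
  move=> j; apply/eqP/eqP => [bE|->]; last by rewrite j0E subKn.
  by apply: val_inj; rewrite /= j0E bE subKn// -ltnS.
case/andP: (coef_geom2_cube R N j0) => -> h /=; apply: (le_trans h).
by apply: lerXn2r; rewrite ?nnegrE ?ler0n// ler_nat.
Qed.

(** The nine generating functions depend on [p.2] only and group into three cubes, to which
    [mehler_cube] applies. Everything holds modulo [X^(N+1)], and [k <= N] makes the coefficient of
    [X^k] exact. *)
Lemma mehler_kernel (x y : 'I_3 -> R) N k : (k <= N)%N ->
  \sum_(a : {ffun idx9 -> 'I_N.+1} | (\sum_p a p == k)%N)
    \prod_p mehler_coef (x p.2) (y p.2) (a p) =
  \sum_(b : {ffun 'I_3 -> 'I_N.+1}) kernel_weight k b *
    \prod_j mehler_coef (sqrt3 * x j) (sqrt3 * y j) (b j).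
Proof.
move=> kN; rewrite -(coef_prod_poly (fun p : idx9 => mehler_coef (x p.2) (y p.2))).
set E := geom2 R N; set Z := fun j => mehler_poly N (sqrt3 * x j) (sqrt3 * y j).
have -> : (\prod_(p : idx9) \poly_(i < N.+1) mehler_coef (x p.2) (y p.2) i)
    = \prod_j mehler_poly N (x j) (y j) ^+ 3.
  rewrite -(pair_bigA _ (fun _ j : 'I_3 => mehler_poly N (x j) (y j)))/= exchange_big/=.
  by apply: eq_bigr => j _; rewrite prodr_const card_ord.
have : 'X^(N.+1) %| \prod_j mehler_poly N (x j) (y j) ^+ 3 - E ^+ 3 * \prod_j Z j.
  rewrite !big_ord_recl !big_ord0 !mulr1.
  (* Telescopes [(u p1)(u p2)(u p3) - z1 z2 z3], multiplies by [E^3], and corrects by [(u E)^3 - 1],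
     which is a multiple of [u E - 1]. *)
  have cancel u (p1 p2 p3 z1 z2 z3 : {poly R}) : 'X^(N.+1) %| u * E - 1 ->
      'X^(N.+1) %| u * p1 - z1 -> 'X^(N.+1) %| u * p2 - z2 -> 'X^(N.+1) %| u * p3 - z3 ->
      'X^(N.+1) %| p1 * (p2 * p3) - E ^+ 3 * (z1 * (z2 * z3)).
    move=> hE h1 h2 h3.
    have -> : p1 * (p2 * p3) - E ^+ 3 * (z1 * (z2 * z3)) =
      E ^+ 3 * (u ^+ 2 * p2 * p3 * (u * p1 - z1) + z1 * u * p3 * (u * p2 - z2)
                + z1 * z2 * (u * p3 - z3))
      - ((u * E) ^+ 2 + u * E + 1) * p1 * p2 * p3 * (u * E - 1) by ring.
    by rewrite dvdp_sub ?dvdp_mull// !dvdp_add ?dvdp_mull.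
  by apply: cancel (geom2P R N) _ _ _; exact: mehler_cube.
have ZE m : (\prod_j Z j)`_m = _ :=
  coef_prod_poly (fun j => mehler_coef (sqrt3 * x j) (sqrt3 * y j)) N m.
move=> /dvdXnP/(_ k); rewrite ltnS kN coefB => /(_ isT)/eqP; rewrite subr_eq0 => /eqP ->.
rewrite coefM.
transitivity (\sum_(j < k.+1) \sum_(b : {ffun 'I_3 -> 'I_N.+1} | (\sum_i b i == k - j)%N)
    (E ^+ 3)`_j * \prod_i mehler_coef (sqrt3 * x i) (sqrt3 * y i) (b i)).
  by apply: eq_bigr => j _; rewrite -big_distrr /= -ZE.
rewrite (exchange_big_dep predT)//=; apply: eq_bigr => b _.
by rewrite mulr_suml.
Qed.

End HermiteKernel.

(** * One-dimensional Hermite functions *)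

Section GaussianPolynomials.
Variable R : realType.
Implicit Types (s c e x y : R) (q : {poly R}) (n m : nat).
Let mu := @lebesgue_measure R.

Lemma gauss_integral c : 0 < c ->
  mu.-integrable setT (EFin \o (fun x => expR (- (c * x) ^+ 2))) /\
  Rintegral mu setT (fun x => expR (- (c * x) ^+ 2)) = Num.sqrt pi / c.
Proof.
(* The standard deviation for which the centred normal density is proportional to [e^(-(c x)^2)]. *)
move=> c0; pose t := (c * Num.sqrt 2)^-1.
have c2 : 0 < c * Num.sqrt 2 by rewrite mulr_gt0// sqrtr_gt0.
have t0 : t != 0 by rewrite invr_neq0// gt_eqF.
have fE : (fun x => expR (- (c * x) ^+ 2)) = normal_fun 0 t.
  apply/funext => x; rewrite /normal_fun subr0; congr expR.
  rewrite /t exprVn !exprMn sqr_sqrtr// -mulr_natr; field.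
  by rewrite gt_eqF.
have pdfE x : normal_fun 0 t x = (normal_peak t)^-1 * normal_pdf 0 t x.
  by rewrite normal_pdfE// mulrA mulVf ?mul1r// gt_eqF// normal_peak_gt0.
have -> : (Num.sqrt pi / c) = (normal_peak t)^-1.
  rewrite /normal_peak invrK -mulr_natr /t exprVn exprMn sqr_sqrtr//.
  have -> : (c ^+ 2 * 2)^-1 * pi * 2 = pi / c ^+ 2 by field; rewrite gt_eqF.
  by rewrite sqrtrM ?pi_ge0// sqrtrV ?sqr_ge0// sqrtr_sqr gtr0_norm.
have ipdf := integrable_normal_pdf 0 t.
rewrite fE; split.
  apply: (@eq_integrable _ _ _ mu _ _
    (fun x => ((normal_peak t)^-1%:E * (normal_pdf 0 t x)%:E)%E)) => //.
    by move=> x _; rewrite -EFinM -pdfE.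
  exact: integrableZl.
rewrite (_ : normal_fun 0 t = fun x => (normal_peak t)^-1 * normal_pdf 0 t x); last exact/funext.
by rewrite (@RintegralZl _ _ _ mu)// /Rintegral integral_normal_pdf mulr1.
Qed.

(** Horner induction: half of the exponent serves the quotient, the other half absorbs the new
    factor [y] through [|y| <= 1 + y^2]. *)
Lemma poly_growth q e : 0 < e ->
  exists2 M : R, 0 <= M & forall y, `|q.[y]| <= M * expR (e * y ^+ 2).
Proof.
elim/poly_ind: q e => [|q c IH] e e0.
  by exists 0 => // y; rewrite horner0 normr0 mul0r.
have e20 : 0 < e / 2 by rewrite divr_gt0.
have [M M0 HM] := IH _ e20.
exists (M * (1 + 2 / e) + `|c|) => [|y].
  by rewrite addr_ge0// mulr_ge0// addr_ge0// divr_ge0// ltW.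
rewrite hornerD hornerM hornerX hornerC (le_trans (ler_normD _ _))// mulrDl lerD//; last first.
  by rewrite ler_peMr// -expR0 ler_expR mulr_ge0 ?sqr_ge0// ltW.
have -> : e * y ^+ 2 = e / 2 * y ^+ 2 + e / 2 * y ^+ 2 by field.
rewrite expRD normrM -mulrA mulrCA mulrA mulrC mulrA [leRHS]mulrC.
have yb : `|y| <= (1 + 2 / e) * expR (e / 2 * y ^+ 2).
  have ye : 1 + y ^+ 2 <= (1 + 2 / e) * (1 + e / 2 * y ^+ 2).
    have -> : (1 + 2 / e) * (1 + e / 2 * y ^+ 2) = 1 + y ^+ 2 + 2 / e + e / 2 * y ^+ 2.
      by field; rewrite gt_eqF.
    have : 0 <= 2 / e by rewrite divr_ge0// ltW.
    have : 0 <= e / 2 * y ^+ 2 by rewrite mulr_ge0 ?sqr_ge0// ltW.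
    lra.
  apply: le_trans (le_trans ye _); last first.
    by rewrite ler_wpM2l ?expR_ge1Dx// addr_ge0// divr_ge0// ltW.
  have := sqr_ge0 (`|y| - 1); rewrite -[y ^+ 2]real_normK ?num_real//.
  have := sqr_ge0 `|y|; nra.
apply: le_trans (ler_pM (normr_ge0 _) (normr_ge0 _) yb (HM y)) _.
by rewrite le_eqVlt; apply/orP; left; apply/eqP; ring.
Qed.

(** The full weight [e^(-(s x)^2)] is that of a product of two Hermite functions at [s x]. The scale
    is [1] for the basis and [sqrt 3] for the diagonal kernel. *)
Definition gauss_poly s q x : R := q.[s * x] * expR (- (s * x) ^+ 2).

Lemma is_derive_horner q x : is_derive x (1 : R) (horner q) (q^`()).[x].
Proof.
apply: DeriveDef; first exact: derivable_horner.
by rewrite derivE derive1E.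
Qed.

Lemma is_derive_gauss_poly s q x :
  is_derive x (1 : R) (gauss_poly s q) (s * gauss_poly s (q^`() - 2%:R *: ('X * q)) x).
Proof.
rewrite (_ : gauss_poly s q = (horner q \o (s \*o id)) *
   (expR \o (- ((s \*o id) ^+ 2)))); last by apply/funext.
have h : is_derive (s * x) (1 : R) (horner q) (q^`()).[s * x] := is_derive_horner q (s * x).
apply: is_derive_eq => /=.
rewrite (_ : (- _ ^+ 2) x = - (s * x) ^+ 2)// /gauss_poly /GRing.scale /= !hornerE/=.
ring.
Qed.

Lemma continuous_gauss_poly s q : continuous (gauss_poly s q).
Proof.
move=> x; apply: differentiable_continuous; apply/derivable1_diffP.
exact: (@ex_derive _ _ _ _ _ _ _ (is_derive_gauss_poly s q x)).
Qed.

Lemma measurable_gauss_poly s q : measurable_fun setT (gauss_poly s q).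
Proof. by apply: measurable_realfun.continuous_measurable_fun; exact: continuous_gauss_poly. Qed.

Lemma gauss_poly_bound s q :
  exists2 M : R, 0 <= M & forall x, `|gauss_poly s q x| <= M * expR (- (s / 2 * x) ^+ 2).
Proof.
(* Three quarters of the exponent are spent on the polynomial; the remaining quarter is
   [(s / 2 * x)^2]. *)
have [|M M0 HM] := @poly_growth q (3 / 4); first by rewrite divr_gt0.
exists M => // x; rewrite normrM [X in _ * X]ger0_norm ?expR_ge0//.
have -> : - (s / 2 * x) ^+ 2 = 3 / 4 * (s * x) ^+ 2 - (s * x) ^+ 2 by field.
by rewrite expRD mulrA ler_wpM2r ?expR_ge0.
Qed.

Lemma integrable_gauss_poly s q : 0 < s ->
  mu.-integrable setT (EFin \o gauss_poly s q).
Proof.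
move=> s0; have [M M0 HM] := gauss_poly_bound s q.
have s20 : 0 < s / 2 by rewrite divr_gt0.
have [ig _] := gauss_integral s20.
apply: le_integrable (integrableZl measurableT M ig) => //.
  by apply/measurable_EFinP; exact: measurable_gauss_poly.
move=> x _; rewrite /= lee_fin (le_trans (HM x))//.
by rewrite ger0_norm// mulr_ge0 ?expR_ge0.
Qed.

(** The sign [sg] covers both ends of the line. The crude bound [e^(-z) <= 1 / (1 + z)] already
    gives decay of order [1 / n]. *)
Lemma cvg_gauss_poly s q (sg : R) : 0 < s -> `|sg| = 1 ->
  (gauss_poly s q (sg * n.+1%:R) @[n --> \oo] --> (0 : R))%classic.
Proof.
move=> s0 sg1; have [M M0 HM] := gauss_poly_bound s q.
set c := s / 2; have c0 : 0 < c by rewrite divr_gt0.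
have bound n : `|gauss_poly s q (sg * n.+1%:R)| <= M * (1 + (c ^+ 2)^-1) * n.+1%:R^-1.
  apply: le_trans (HM _) _; rewrite -/c -[leRHS]mulrA ler_wpM2l// expRN.
  have -> : (c * (sg * n.+1%:R)) ^+ 2 = c ^+ 2 * n.+1%:R ^+ 2.
    by rewrite !exprMn -[sg ^+ 2]real_normK ?num_real// sg1 expr1n mul1r.
  have n0 : (0 : R) < n.+1%:R by rewrite ltr0n.
  have n1 : (1 : R) <= n.+1%:R by rewrite ler1n.
  have c20 : 0 < c ^+ 2 by rewrite exprn_gt0.
  rewrite -ler_pV2 ?inE ?unitfE ?gt_eqF ?invr_gt0 ?expR_gt0 ?mulr_gt0 ?addr_gt0 ?invr_gt0 //=.
  rewrite invrK; apply: le_trans (expR_ge1Dx _).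
  rewrite invfM invrK ler_pdivrMl ?addr_gt0 ?invr_gt0//.
  have -> : (1 + (c ^+ 2)^-1) * (1 + c ^+ 2 * n.+1%:R ^+ 2) =
    1 + (c ^+ 2)^-1 + c ^+ 2 * n.+1%:R ^+ 2 + n.+1%:R ^+ 2 by field; rewrite gt_eqF.
  have : 0 < (c ^+ 2)^-1 by rewrite invr_gt0.
  have : 0 <= c ^+ 2 * n.+1%:R ^+ 2 by rewrite mulr_ge0 ?sqr_ge0 ?ltW.
  nra.
apply/norm_cvg0P; apply: (@squeeze_cvgr _ _ _ _ (cst 0)
  (fun n => M * (1 + (c ^+ 2)^-1) * n.+1%:R^-1)).
- by apply: nearW => n; rewrite normr_ge0 bound.
- exact: cvg_cst.
- rewrite -[X in (_ --> X)%classic](mulr0 (M * (1 + (c ^+ 2)^-1))).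
  by apply: cvgMr; exact: cvg_harmonic.
Qed.

(** Up to the factor [s] the integrand is the derivative of [gauss_poly s q]: the fundamental
    theorem on growing intervals leaves vanishing boundary terms, and dominated convergence passes
    to the whole line. *)
Lemma integral_deriv_gauss_poly s q : 0 < s ->
  Rintegral mu setT (gauss_poly s (q^`() - 2%:R *: ('X * q))) = 0.
Proof.
move=> s0; set r := _ - _; set F := gauss_poly s q.
have ir := integrable_gauss_poly r s0.
pose A n : set (measurableTypeR R) := `[- n.+1%:R, n.+1%:R]%classic.
pose f_ n x := ((gauss_poly s r \_ (A n)) x)%:E.
have mA n : measurable (A n) by exact: measurable_itv.
have FTC n : (\int[mu]_x f_ n x = (s^-1 * (F n.+1%:R - F (- n.+1%:R)))%:E)%E.
  have h : (\int[mu]_(x in A n) (s * gauss_poly s r x)%:E = (F n.+1%:R)%:E -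
    (F (- n.+1%:R))%:E)%E.
    apply: continuous_FTC2.
    - by rewrite gtrN// ltr0n.
    - apply: continuous_subspaceT => x; apply: cvgMr; exact: continuous_gauss_poly.
    - split.
      + by move=> x _; exact: (@ex_derive _ _ _ _ _ _ _ (is_derive_gauss_poly s q x)).
      + by apply: cvg_at_right_filter; exact: continuous_gauss_poly.
      + by apply: cvg_at_left_filter; exact: continuous_gauss_poly.
    - by move=> x _; rewrite derive1E (@derive_val _ _ _ _ _ _ _ (is_derive_gauss_poly s q x)).
  have irA : mu.-integrable (A n) (EFin \o gauss_poly s r).
    by apply: (@integrableS _ _ _ mu setT) => //.
  move: h; under eq_integral do rewrite EFinM.
  rewrite integralZl// => h.
  rewrite EFinM EFinB -h muleA -EFinM mulVf ?gt_eqF// mul1e [RHS]integral_mkcond.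
  by apply: eq_integral => x _; rewrite /f_ restrict_EFin.
have mr : measurable_fun [set: measurableTypeR R] (EFin \o gauss_poly s r).
  by apply/measurable_EFinP; exact: measurable_gauss_poly.
have mf_ n : measurable_fun [set: measurableTypeR R] (f_ n).
  by apply/measurable_EFinP; apply/(measurable_restrictT _ (mA n)); apply: measurable_funTS;
    exact: measurable_gauss_poly.
have cvgf : {ae mu, forall x, [set: measurableTypeR R]%classic x ->
    (f_ n x @[n --> \oo] --> (EFin \o gauss_poly s r) x)%classic}.
  apply: aeW => x _; apply: cvg_near_cst; near=> n.
  rewrite /f_ patchE ifT//; apply/mem_set; rewrite /A /= in_itv /= -ler_norml.
  apply: ltW; apply: (@lt_trans _ _ n%:R); last by rewrite ltr_nat.
  by near: n; exact: nbhs_infty_gtr.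
have bd : {ae mu, forall x n, [set: measurableTypeR R]%classic x ->
    (`|f_ n x| <= (abse \o (EFin \o gauss_poly s r)) x)%E}.
  apply: aeW => x n _; rewrite /f_ /= lee_fin patchE.
  by case: ifP => // _; rewrite normr0.
have [_ _] := dominated_convergence measurableT mf_ mr cvgf (integrable_abse ir) bd.
under eq_fun do rewrite FTC.
have lim0 : ((s^-1 * (F n.+1%:R - F (- n.+1%:R)))%:E @[n --> \oo] --> (0 : R)%:E)%classic.
  apply: cvg_EFin; first exact: nearW.
  rewrite -[X in (_ --> X)%classic](mulr0 s^-1); apply: cvgMr.
  rewrite -[X in (_ --> X)%classic](subr0 0); apply: cvgB.
    by under eq_fun do rewrite -[_.+1%:R]mul1r; apply: cvg_gauss_poly; rewrite ?normr1.
  by under eq_fun do rewrite -mulN1r; apply: cvg_gauss_poly; rewrite ?normrN1.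
by move=> /(cvg_unique _ lim0) h; rewrite /Rintegral -h.
Unshelve. all: by end_near.
Qed.

(* With w = e^{-(s x)^2}, (H_k q w)' is a multiple of (H_k q' - H_{k+1} q) w, so the
   integral of H_{k+1} q w equals that of H_k q' w. *)
Lemma hermite_orthogonal s n m : 0 < s ->
  Rintegral mu setT (gauss_poly s (hermite_poly R n * hermite_poly R m)) =
  (n == m)%:R * (2 ^+ n * n`!%:R * Num.sqrt pi / s).
Proof.
move=> s0; pose L q := Rintegral mu setT (gauss_poly s q).
have LB (p q : {poly R}) : L (p - q) = L p - L q.
  rewrite /L -(@RintegralB _ _ _ mu)//; try exact: integrable_gauss_poly.
  by apply: eq_Rintegral => x _; rewrite /gauss_poly hornerD hornerN mulrBl.
have LZ (c : R) (q : {poly R}) : L (c *: q) = c * L q.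
  rewrite /L -(@RintegralZl _ _ _ mu)//; try exact: integrable_gauss_poly.
  by apply: eq_Rintegral => x _; rewrite /gauss_poly hornerZ mulrA.
have LD (p q : {poly R}) : L (p + q) = L p + L q.
  have LN : L (- q) = - L q by rewrite -scaleN1r LZ mulN1r.
  by rewrite -[q in LHS]opprK LB LN opprK.
have step k q : L (hermite_poly R k.+1 * q) = L (hermite_poly R k * q^`()).
  have := integral_deriv_gauss_poly (hermite_poly R k * q) s0.
  rewrite -/(L _) LB derivM LD => /eqP; rewrite subr_eq0 => /eqP h.
  have -> : hermite_poly R k.+1 * q
      = 2%:R *: ('X * (hermite_poly R k * q)) - (hermite_poly R k)^`() * q.
    by rewrite hermiteS mulrBl -scalerAl mulrA.
  by rewrite LB -h addrAC subrr add0r.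
have L0 : L 0 = 0 by rewrite -(scale0r 0) LZ mul0r.
have L1 q : L (hermite_poly R 0 * q) = L q by rewrite mul1r.
have LS k : L (hermite_poly R k.+1) = 0.
  by rewrite -[hermite_poly R k.+1]mulr1 step derivC mulr0.
change (L (hermite_poly R n * hermite_poly R m) = (n == m)%:R *
  (2 ^+ n * n`!%:R * Num.sqrt pi / s)).
elim: n m => [|n IH] [|m]; rewrite ?L1 ?LS ?mul0r//.
- rewrite /L (_ : gauss_poly s _ = fun x => expR (- (s * x) ^+ 2)).
    by rewrite (gauss_integral s0).2 expr0 fact0 !mul1r.
  by apply/funext => x; rewrite /gauss_poly hornerC mul1r.
- by rewrite mulr1 LS.
rewrite step deriv_hermite -scalerAr LZ IH eqSS; case: eqP => [->|_];
  last by rewrite !mul0r mulr0.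
by rewrite !mul1r factS !natrM exprS; ring.
Qed.

Lemma hermite_funM s n m x :
  hermite_fun n (s * x) * hermite_fun m (s * x) =
  (Num.sqrt (2 ^+ n * n`!%:R * Num.sqrt pi))^-1 * (Num.sqrt (2 ^+ m * m`!%:R * Num.sqrt pi))^-1
  * gauss_poly s (hermite_poly R n * hermite_poly R m) x.
Proof.
rewrite /hermite_fun /gauss_poly hornerM.
have -> : - (s * x) ^+ 2 = - ((s * x) ^+ 2 / 2) + - ((s * x) ^+ 2 / 2) by field.
rewrite expRD; ring.
Qed.

Lemma integrable_hermite_funM s n m : 0 < s ->
  mu.-integrable setT (EFin \o (fun x => hermite_fun n (s * x) * hermite_fun m (s * x))).
Proof.
move=> s0; pose c : R := (Num.sqrt (2 ^+ n * n`!%:R * Num.sqrt pi))^-1 *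
  (Num.sqrt (2 ^+ m * m`!%:R * Num.sqrt pi))^-1.
rewrite (_ : EFin \o _ = fun x =>
    (c%:E * (gauss_poly s (hermite_poly R n * hermite_poly R m) x)%:E)%E).
  by apply: integrableZl => //; exact: integrable_gauss_poly.
by apply/funext => x; rewrite -EFinM /= hermite_funM.
Qed.

Lemma hermite_fun_orthonormal s n m : 0 < s ->
  Rintegral mu setT (fun x => hermite_fun n (s * x) * hermite_fun m (s * x)) =
  (n == m)%:R / s.
Proof.
move=> s0; under eq_Rintegral do rewrite hermite_funM.
rewrite (@RintegralZl _ _ _ mu)//; last exact: integrable_gauss_poly.
rewrite hermite_orthogonal//; case: eqP => [->|_]; last by rewrite !mul0r mulr0.
set a := _ * Num.sqrt pi; have a0 : 0 < a.
  by rewrite !mulr_gt0 ?exprn_gt0 ?ltr0n ?fact_gt0 ?sqrtr_gt0 ?pi_gt0.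
rewrite -invfM -expr2 sqr_sqrtr ?ltW//; field.
by rewrite !gt_eqF.
Qed.

Lemma continuous_hermite_fun n : continuous (@hermite_fun R n).
Proof.
have c1 : continuous (horner (hermite_poly R n)).
  by move=> y; apply: differentiable_continuous; apply/derivable1_diffP; exact: derivable_horner.
have c2 : continuous (fun y : R => - (y ^+ 2 / 2)).
  by move=> y; apply: cvgN; apply: cvgMl; exact: exprn_continuous.
move=> x; apply: cvgM; first by apply: cvgMr; exact: c1.
by apply: (continuous_comp (c2 x)); exact: continuous_expR.
Qed.

Lemma measurable_hermite_fun n : measurable_fun setT (@hermite_fun R n).
Proof. exact: measurable_realfun.continuous_measurable_fun (@continuous_hermite_fun n). Qed.

End GaussianPolynomials.

(** * Square-integrable functions *)

Section SquareIntegrable.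
Context d (T : measurableType d) (R : realType).
Variable mu : {measure set T -> \bar R}.
Implicit Types f g h : T -> R.

(** Real-valued on purpose: complex functions enter through their real and imaginary parts, which
    keeps [inner] symmetric and bilinear. *)
Definition sqint f : Prop :=
  measurable_fun setT f /\ (\int[mu]_x (f x ^+ 2)%:E < +oo)%E.

Definition inner f g : R := Rintegral mu setT (fun x => f x * g x).

Lemma sqint_integrable f : sqint f -> mu.-integrable setT (EFin \o (fun x => f x ^+ 2)).
Proof.
move=> [mf f2]; apply/integrableP; split.
  by apply/measurable_EFinP; exact: measurable_funX.
by under eq_integral do rewrite /= ger0_norm ?sqr_ge0//.
Qed.

Lemma sqint_integrableM f g : sqint f -> sqint g ->
  mu.-integrable setT (EFin \o (fun x => f x * g x)).
Proof.
move=> sf sg.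
have i2 := integrableD measurableT (sqint_integrable sf) (sqint_integrable sg).
apply: le_integrable i2 => //.
  by apply/measurable_EFinP; apply: measurable_funM; [exact: sf.1|exact: sg.1].
move=> x _; rewrite /= lee_fin [leRHS]ger0_norm ?addr_ge0 ?sqr_ge0// normrM.
have := sqr_ge0 (`|f x| - `|g x|); have := sqr_ge0 (`|f x|); have := sqr_ge0 (`|g x|).
rewrite -[f x ^+ 2]real_normK ?num_real// -[g x ^+ 2]real_normK ?num_real//; nra.
Qed.

Lemma sqintD f g : sqint f -> sqint g -> sqint (fun x => f x + g x).
Proof.
move=> sf sg; split; first by apply: measurable_funD; [exact: sf.1|exact: sg.1].
have i1 := integrableD measurableT (sqint_integrable sf) (sqint_integrable sg).
have i2 := sqint_integrableM sf sg.
have /integrableP[_] := integrableD measurableT i1 (integrableD measurableT i2 i2).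
apply: le_lt_trans; apply: ge0_le_integral => //.
- by move=> x _; rewrite lee_fin sqr_ge0.
- by apply/measurable_EFinP; apply: measurable_funX; apply: measurable_funD;
  [exact: sf.1|exact: sg.1].
- apply/measurableT_comp => //; apply/measurable_EFinP.
  have [mf mg] := (sf.1, sg.1).
  by do 2 apply: measurable_funD; do ?[apply: measurable_funX | apply: measurable_funM] => //.
- move=> x _; rewrite /= lee_fin; apply: le_trans (ler_norm _).
  by rewrite sqrrD mulr2n; lra.
Qed.

Lemma sqintZ (c : R) f : sqint f -> sqint (fun x => c * f x).
Proof.
move=> sf; split; first by apply: measurable_funM => //; exact: sf.1.
under eq_integral do rewrite exprMn EFinM.
rewrite integralZl//; last exact: sqint_integrable.
by rewrite lte_mul_pinfty ?lee_fin ?sqr_ge0//; exact: sf.2.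
Qed.

Lemma sqint0 : sqint (fun=> 0).
Proof. by split => //; under eq_integral do rewrite expr0n; rewrite integral0. Qed.

Lemma sqint_sum (I : Type) (s : seq I) (P : pred I) (c : I -> R) (e : I -> T -> R) :
  (forall i, sqint (e i)) -> sqint (fun x => \sum_(i <- s | P i) c i * e i x).
Proof.
move=> se; elim: s => [|i s IH].
  by under eq_fun do rewrite big_nil; exact: sqint0.
under eq_fun do rewrite big_cons; case: (P i) => //.
by apply: sqintD => //; exact: sqintZ.
Qed.

Lemma sqint_le (f g : T -> R) (M : R) : measurable_fun setT f -> sqint g ->
  (forall x, `|f x| <= M * `|g x|) -> sqint f.
Proof.
move=> mf sg fg; split => //.
apply: le_lt_trans (sqintZ M sg).2; apply: ge0_le_integral => //.
- by move=> x _; rewrite lee_fin sqr_ge0.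
- by apply/measurable_EFinP; apply: measurable_funX.
- by apply/measurable_EFinP; apply: measurable_funX; apply: measurable_funM => //; exact: sg.1.
- move=> x _; rewrite lee_fin -[f x ^+ 2]real_normK ?num_real// -[leRHS]real_normK ?num_real//.
  apply: lerXn2r; rewrite ?nnegrE// normrM; apply: le_trans (fg x) _.
  by rewrite ler_wpM2r// ler_norm.
Qed.

Lemma innerC f g : inner f g = inner g f.
Proof. by apply: eq_Rintegral => x _; rewrite mulrC. Qed.

Lemma inner_sum (I : Type) (s : seq I) (P : pred I) (c : I -> R) (e : I -> T -> R) g :
  (forall i, sqint (e i)) -> sqint g ->
  inner (fun x => \sum_(i <- s | P i) c i * e i x) g =
  \sum_(i <- s | P i) c i * inner (e i) g.
Proof.
move=> se sg; elim: s => [|i s IH].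
  rewrite big_nil /inner; under eq_Rintegral do rewrite big_nil mul0r.
  by rewrite /Rintegral integral0.
rewrite big_cons /inner; under eq_Rintegral do rewrite big_cons.
case: (P i) => //; under eq_Rintegral do rewrite mulrDl -mulrA.
rewrite (@RintegralD _ _ _ mu)//; last 2 first.
- rewrite (_ : EFin \o _ = fun x => ((c i)%:E * (e i x * g x)%:E)%E)//.
  by apply: integrableZl => //; exact: sqint_integrableM.
- by apply: sqint_integrableM => //; exact: sqint_sum.
by rewrite (@RintegralZl _ _ _ mu)//; [rewrite -IH|exact: sqint_integrableM].
Qed.

Lemma inner_ge0 f : 0 <= inner f f.
Proof. by apply: Rintegral_ge0 => x _; rewrite -expr2 sqr_ge0. Qed.

Lemma inner_integral f : sqint f -> (\int[mu]_x (f x ^+ 2)%:E)%E = (inner f f)%:E.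
Proof.
move=> sf; rewrite /inner /Rintegral fineK//.
by have /integrable_fin_num := sqint_integrableM sf sf; apply.
Qed.

(** [k] is the common squared norm of the family; it lets unnormalised families, such as the time
    waves with [k = pi], be used as they are. *)
Lemma parseval (I : finType) (P : pred I) (e : I -> T -> R) (k : R) (c : I -> R) :
  (forall i, sqint (e i)) -> (forall i j, inner (e i) (e j) = (i == j)%:R * k) ->
  inner (fun x => \sum_(i | P i) c i * e i x) (fun x => \sum_(i | P i) c i * e i x)
    = k * \sum_(i | P i) c i ^+ 2.
Proof.
move=> se oe; rewrite inner_sum//; last exact: sqint_sum.
rewrite mulr_sumr; apply: eq_bigr => i Pi.
rewrite innerC inner_sum// (bigD1 i)//= oe eqxx big1 => [|j /andP[_ ji]].
  by rewrite mul1r addr0; ring.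
by rewrite oe (negbTE ji) mul0r mulr0.
Qed.

(** The squared norm of [f - p] is nonnegative, where [p] is the orthogonal projection of [f] on the
    span of the selected [e i]. *)
Lemma bessel (I : finType) (P : pred I) (e : I -> T -> R) (k : R) f :
  0 < k -> (forall i, sqint (e i)) ->
  (forall i j, inner (e i) (e j) = (i == j)%:R * k) -> sqint f ->
  \sum_(i | P i) inner f (e i) ^+ 2 <= k * inner f f.
Proof.
move=> k0 se oe sf; pose a i := inner f (e i) / k.
pose p x := \sum_(i | P i) a i * e i x.
have sp : sqint p by exact: sqint_sum.
have : 0 <= inner (fun x => f x + (- 1) * p x) (fun x => f x + (- 1) * p x).
  exact: inner_ge0.
have smp : sqint (fun x => (- 1) * p x) by exact: sqintZ.
have innerDl g h1 h2 : sqint h1 -> sqint h2 -> sqint g ->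
    inner (fun x => h1 x + h2 x) g = inner h1 g + inner h2 g.
  move=> s1 s2 sg; rewrite /inner -(@RintegralD _ _ _ mu)//; try exact: sqint_integrableM.
  by apply: eq_Rintegral => x _; rewrite mulrDl.
have innerZl c h1 g : sqint h1 -> sqint g -> inner (fun x => c * h1 x) g = c * inner h1 g.
  move=> s1 sg; rewrite /inner -(@RintegralZl _ _ _ mu)//; try exact: sqint_integrableM.
  by apply: eq_Rintegral => x _; rewrite mulrA.
have sd : sqint (fun x => f x + (- 1) * p x) by exact: sqintD.
have qE g : sqint g -> inner (fun x => f x + (- 1) * p x) g = inner f g - inner p g.
  by move=> sg; rewrite innerDl// innerZl// mulN1r.
rewrite qE// (innerC f) (innerC p) !qE// (innerC f p).
have fp : inner p f = k^-1 * \sum_(i | P i) inner f (e i) ^+ 2.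
  rewrite inner_sum// mulr_sumr; apply: eq_bigr => i _.
  by rewrite innerC /a; ring.
have pp : inner p p = k^-1 * \sum_(i | P i) inner f (e i) ^+ 2.
  rewrite (parseval _ _ se oe) !mulr_sumr; apply: eq_bigr => i _.
  by rewrite /a; field; rewrite gt_eqF.
rewrite fp pp => h.
rewrite -subr_ge0 -(pmulr_rge0 _ (_ : 0 < k^-1)) ?invr_gt0// mulrBr mulKf ?gt_eqF//.
lra.
Qed.

(* A T T^* argument: with G the left-hand function and m_i = <psi_i, G>, integrating the kernel
   identity twice against G gives sum m_i^2 = sum w_j <phi_j, G>^2 <= W k |G|^2 by Bessel, while
   |G|^2 = sum c_i m_i. *)
Lemma kernel_bound (I J : finType) (P : pred I) (psi : I -> T -> R) (phi : J -> T -> R)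
    (w : J -> R) (W k : R) (c : I -> R) :
  0 < k -> 0 < W -> (forall i, sqint (psi i)) -> (forall j, sqint (phi j)) ->
  (forall i j, inner (phi i) (phi j) = (i == j)%:R * k) ->
  (forall j, 0 <= w j <= W) ->
  (forall x y, \sum_(i | P i) psi i x * psi i y = \sum_j w j * (phi j x * phi j y)) ->
  inner (fun x => \sum_(i | P i) c i * psi i x) (fun x => \sum_(i | P i) c i * psi i x)
    <= W * k * \sum_(i | P i) c i ^+ 2.
Proof.
move=> k0 W0 spsi sphi ophi wW K.
set G := (fun x => _); have sG : sqint G by exact: sqint_sum.
pose m i := inner (psi i) G; pose n j := inner (phi j) G.
have step y : \sum_(i | P i) m i * psi i y = \sum_j w j * n j * phi j y.
  transitivity (inner (fun x => \sum_(i | P i) psi i y * psi i x) G).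
    by rewrite inner_sum//; apply: eq_bigr => i _; rewrite mulrC.
  transitivity (inner (fun x => \sum_j (w j * phi j y) * phi j x) G).
    apply: eq_Rintegral => x _; rewrite K; congr (_ * _); apply: eq_bigr => j _; ring.
  by rewrite inner_sum//; apply: eq_bigr => j _; rewrite /n; ring.
have m2 : \sum_(i | P i) m i ^+ 2 = \sum_j w j * n j ^+ 2.
  transitivity (inner (fun x => \sum_(i | P i) m i * psi i x) G).
    by rewrite inner_sum//.
  transitivity (inner (fun x => \sum_j (w j * n j) * phi j x) G).
    by apply: eq_Rintegral => x _; rewrite step.
  by rewrite inner_sum//; apply: eq_bigr => j _; rewrite /n; ring.
have m2W : \sum_(i | P i) m i ^+ 2 <= W * k * inner G G.
  rewrite m2; apply: (@le_trans _ _ (W * \sum_j n j ^+ 2)).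
    rewrite mulr_sumr; apply: ler_sum => j _; rewrite ler_wpM2r ?sqr_ge0//.
    by have /andP[] := wW j.
  rewrite -mulrA; apply: ler_wpM2l; first exact: ltW.
  have -> : \sum_j n j ^+ 2 = \sum_j inner G (phi j) ^+ 2.
    by apply: eq_bigr => j _; rewrite innerC.
  exact: bessel.
have GG : inner G G = \sum_(i | P i) c i * m i by rewrite inner_sum.
have Wk : 0 < W * k by rewrite mulr_gt0.
(* The termwise inequality [2 a b <= a^2 + b^2] replaces Cauchy-Schwarz and avoids dividing by the
   norm of [G]: with [m2W] it gives [2 W k |G|^2 <= (W k)^2 s + W k |G|^2], where [s] is the sum of
   the [c_i^2]. *)
have : \sum_(i | P i) 2 * (W * k) * (c i * m i) <=
    \sum_(i | P i) ((W * k) ^+ 2 * c i ^+ 2 + m i ^+ 2).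
  by apply: ler_sum => i _; have := sqr_ge0 (W * k * c i - m i); nra.
rewrite -mulr_sumr -GG big_split/= -mulr_sumr.
move: (\sum_(i | P i) c i ^+ 2) m2W => s m2W h.
rewrite -(ler_pM2l Wk).
nra.
Qed.

End SquareIntegrable.

(** * Completeness of L^2 with an explicit rate *)

Section RieszFischer.
Local Open Scope classical_set_scope.
Context d (T : measurableType d) (R : realType).
Variable mu : {measure set T -> \bar R}.

(** The rate [4^-j] beats the weight [2^j] of [cvg_of_summable_sq]; [j <= n_ j] places late terms
    beyond any given index. *)
Lemma fast_subsequence (tau : nat -> R) : tau @ \oo --> (0 : R) ->
  exists n_ : nat -> nat, {homo n_ : i j / (i <= j)%N} /\
    forall j, (j <= n_ j)%N /\ forall m, (n_ j <= m)%N -> tau m <= 4^-1 ^+ j.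
Proof.
move=> tau0.
have /choice[p pP] : forall j, exists p, forall m, (p <= m)%N -> tau m <= 4^-1 ^+ j.
  move=> j; have e0 : (0 : R) < 4^-1 ^+ j by rewrite exprn_gt0// invr_gt0.
  move/cvgrPdist_le : tau0 => /(_ _ e0)[p _ pP]; exists p => m pm.
  by have := pP m pm; rewrite /= sub0r normrN; apply: le_trans; exact: ler_norm.
(* Summing the thresholds makes the sequence monotone while staying above each [p j]. *)
exists (fun j => j + \sum_(i < j.+1) p i)%N; split.
  apply: homo_leq => // [i j k /leq_trans|j]; first exact.
  by rewrite (big_ord_recr j.+1) /= leq_add ?leq_addr.
move=> j; split; first exact: leq_addr.
move=> m /(leq_trans _) h; apply: pP; apply: h.
by rewrite big_ord_recr /= addnA leq_addl.
Qed.

Lemma sum_half n : \sum_(k < n) 2^-1 ^+ k <= 2 :> R.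
Proof.
have -> : \sum_(k < n) 2^-1 ^+ k = 2 - 2 * 2^-1 ^+ n :> R.
  elim: n => [|n IH]; first by rewrite big_ord0 expr0; ring.
  by rewrite big_ord_recr /= IH exprS; field.
by rewrite gerBl mulr_ge0// exprn_ge0// invr_ge0.
Qed.

(* 2 |d| <= 2^-j + 2^j d^2, so the increments are absolutely summable. *)
Lemma cvg_of_summable_sq (w : nat -> R) :
  (\sum_(0 <= j <oo) (2 ^+ j * (w j.+1 - w j) ^+ 2)%:E < +oo)%E -> cvgn w.
Proof.
set S := (X in (X < _)%E) => Soo.
have S0 : (0 <= S)%E by apply: nneseries_ge0 => j _ _;
  rewrite lee_fin mulr_ge0 ?sqr_ge0 ?exprn_ge0.
have Sfin : S \is a fin_num by rewrite ge0_fin_numE.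
have part n : \sum_(0 <= j < n) 2 ^+ j * (w j.+1 - w j) ^+ 2 <= fine S.
  rewrite -lee_fin fineK// -sumEFin; apply: nneseries_lim_ge => j _ _.
  by rewrite lee_fin mulr_ge0 ?sqr_ge0 ?exprn_ge0.
have cs : cvgn (series (fun j => w j.+1 - w j)).
  apply: normed_cvg; apply: nondecreasing_is_cvgn.
    by apply: nondecreasing_series => j _ _; exact: normr_ge0.
  exists (1 + fine S / 2) => _ [n _ <-].
  rewrite /series /=; apply: (@le_trans _ _ (\sum_(0 <= j < n)
    (2^-1 * 2^-1 ^+ j + 2^-1 * (2 ^+ j * (w j.+1 - w j) ^+ 2)))).
    apply: ler_sum => j _; have p0 : (0 : R) < 2 ^+ j by rewrite exprn_gt0.
    rewrite exprVn -(ler_pM2l p0) mulrDr [X in _ <= X + _]mulrCA divff ?gt_eqF//.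
    have := sqr_ge0 (2 ^+ j * `|w j.+1 - w j| - 1).
    rewrite -[(w _ - _) ^+ 2]real_normK ?num_real//; nra.
  rewrite big_split /= -!mulr_sumr; apply: lerD.
    by have := sum_half n; rewrite big_mkord; lra.
  by rewrite mulrC ler_wpM2r ?invr_ge0.
rewrite (_ : w = fun n => w 0%N + series (fun j => w j.+1 - w j) n).
  by apply: is_cvgD => //; exact: is_cvg_cst.
by apply/funext => n; rewrite /series /= telescope_sumr// subrKC.
Qed.

(** A fast subsequence converges almost everywhere, and Fatou's lemma carries the Cauchy bound to
    its limit, so the rate [tau] survives unchanged. *)
Lemma riesz_fischer (V : nat -> T -> R) (tau : nat -> R) :
  (forall n, measurable_fun setT (V n)) -> tau @ \oo --> (0 : R) ->
  (forall m n, (m <= n)%N -> (\int[mu]_x ((V n x - V m x) ^+ 2)%:E <= (tau m)%:E)%E) ->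
  exists v : T -> R, measurable_fun setT v /\
    forall m, (\int[mu]_x ((V m x - v x) ^+ 2)%:E <= (tau m)%:E)%E.
Proof.
move=> mV tau0 Vtau.
have [n_ [nmono n_P]] := fast_subsequence tau0.
pose W j := V (n_ j).
pose S x := (\sum_(0 <= j <oo) (2 ^+ j * (W j.+1 x - W j x) ^+ 2)%:E)%E.
have mdiff i j : measurable_fun setT (fun x => ((V i x - V j x) ^+ 2)%:E).
  by apply/measurable_EFinP; apply: measurable_funX; apply: measurable_funB.
have mS_ j : measurable_fun setT (fun x => (2 ^+ j * (W j.+1 x - W j x) ^+ 2)%:E).
  by apply/measurable_EFinP; apply: measurable_funM => //; apply/measurable_EFinP; exact: mdiff.
have S_0 j x : (0 <= (2 ^+ j * (W j.+1 x - W j x) ^+ 2)%:E)%E.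
  by rewrite lee_fin mulr_ge0 ?sqr_ge0 ?exprn_ge0.
have S0 x : (0 <= S x)%E by apply: nneseries_ge0.
have mS : measurable_fun setT S by apply: ge0_emeasurable_sum => // j x _ _; exact: S_0.
(* Termwise, the integral of [S] is at most the sum of [2^j 4^-j], hence at most 2; so [S] is
   finite, and [W] converges, almost everywhere. *)
have iS : mu.-integrable setT S.
  apply/integrableP; split => //.
  under eq_integral do rewrite gee0_abs//.
  rewrite integral_nneseries//; apply: (@le_lt_trans _ _ 2%:E); last exact: ltry.
  apply: lime_le; first by apply: is_cvg_nneseries => j _ _; exact: integral_ge0.
  apply: nearW => n; apply: (@le_trans _ _ (\sum_(0 <= j < n) (2^-1 ^+ j)%:E)%E).
    apply: lee_sum => j _; under eq_integral do rewrite EFinM.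
    rewrite ge0_integralZl//; last 2 first.
    - exact: mdiff.
    - by move=> x _; rewrite lee_fin sqr_ge0.
    have -> : (2^-1 ^+ j)%:E = ((2 ^+ j)%:E * (4^-1 ^+ j)%:E)%E :> \bar R.
      by rewrite -EFinM -exprMn; congr ((_ ^+ _)%:E); field.
    apply: lee_wpmul2l; first by rewrite lee_fin exprn_ge0.
    apply: le_trans (Vtau _ _ (nmono _ _ (leqnSn j))) _.
    by rewrite lee_fin; apply: (n_P j).2.
  by rewrite sumEFin lee_fin big_mkord sum_half.
have aecvg : {ae mu, forall x, setT x -> cvgn (W ^~ x)}.
  have := integrable_ae measurableT iS.
  apply: filterS => x Sx Tx; apply: cvg_of_summable_sq.
  by have := Sx Tx; rewrite ge0_fin_numE.
(* The upper limit is measurable everywhere and equals the limit wherever [W] converges. *)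
pose v x := fine (limn_esup (fun j => (W j x)%:E)).
have mv : measurable_fun setT v.
  apply: measurableT_comp; first exact: fine_measurable.
  by apply: measurable_fun_limn_esup => j; apply/measurable_EFinP; exact: mV.
exists v; split => // m.
(* The shift by [m] ensures [m <= n_ (j + m)], so that the Cauchy bound applies to every term. *)
pose f j x := ((V m x - W (j + m)%N x) ^+ 2)%:E.
have mf j : measurable_fun setT (f j) by exact: mdiff.
have f0 j x : (0 <= f j x)%E by rewrite lee_fin sqr_ge0.
have aeE : {ae mu, forall x, setT x -> limn_einf (f ^~ x) = ((V m x - v x) ^+ 2)%:E}.
  apply: filterS aecvg => x Wx Tx; have {}Wx := Wx Tx.
  have vE : v x = limn (W ^~ x).
    have Wc : (W j x)%:E @[j --> \oo] --> (limn (W ^~ x))%:E.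
      by apply: cvg_EFin; [exact: nearW|exact: Wx].
    by rewrite /v (cvg_limn_einf_sup Wc).2.
  apply: (cvg_limn_einf_sup _).1; apply: cvg_EFin; first exact: nearW.
  have Wm : W (j + m)%N x @[j --> \oo] --> limn (W ^~ x).
    by have := Wx; rewrite -(cvg_shiftn m).
  by apply: cvgM; apply: cvgB; rewrite ?vE //; exact: cvg_cst.
have := fatou mu measurableT mf (fun j x _ => f0 j x).
have mlim : measurable_fun setT (fun x => limn_einf (f ^~ x)).
  have -> : (fun x => limn_einf (f ^~ x)) = -%E \o (fun x => limn_esup (fun j => - f j x)%E) by
    [].
  apply: measurableT_comp => //; apply: measurable_fun_limn_esup => j.
  exact: measurableT_comp.
have mVv : measurable_fun setT (fun x => ((V m x - v x) ^+ 2)%:E).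
  by apply/measurable_EFinP; apply: measurable_funX; apply: measurable_funB.
rewrite (ae_eq_integral _ _ measurableT mlim mVv aeE).
move=> /le_trans; apply.
rewrite limn_einf_lim; apply: lime_le; first exact: is_cvg_einfs.
apply: nearW => j; apply: ereal_inf_le; exists (\int[mu]_x f j x)%E; first by exists j => /=.
under eq_integral do rewrite /f -sqrrN opprB.
apply: Vtau; apply: leq_trans (n_P _).1.
exact: leq_addl.
Qed.

End RieszFischer.

(** * Products of one-variable functions *)

Section TensorIntegral.
Context d1 d2 (T1 : measurableType d1) (T2 : measurableType d2) (R : realType).
Variables (m1 : {sigma_finite_measure set T1 -> \bar R})
  (m2 : {sigma_finite_measure set T2 -> \bar R}).

Lemma integrable_tensor (f : T1 -> R) (g : T2 -> R) :
  m1.-integrable setT (EFin \o f) -> m2.-integrable setT (EFin \o g) ->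
  (m1 \x m2)%E.-integrable setT (EFin \o (fun z => f z.1 * g z.2)).
Proof.
move=> fi gi; have /integrableP[/measurable_EFinP mf foo] := fi.
have /integrableP[/measurable_EFinP mg goo] := gi.
have mfg : measurable_fun setT (EFin \o (fun z : T1 * T2 => f z.1 * g z.2)).
  apply/measurable_EFinP; apply: measurable_funM.
    by apply: measurableT_comp => //; exact: measurable_fst.
  by apply: measurableT_comp => //; exact: measurable_snd.
apply/integrable12ltyP => //=.
have -> : (\int[m1]_x \int[m2]_y `|(f x * g y)%:E| =
           \int[m1]_x (`|(f x)%:E| * \int[m2]_y `|(g y)%:E|))%E.
  apply: eq_integral => x _; under eq_integral do rewrite EFinM abseM.
  by rewrite ge0_integralZl//; apply: measurableT_comp => //; exact/measurable_EFinP.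
rewrite ge0_integralZr//; last 2 first.
- by apply: measurableT_comp => //; exact/measurable_EFinP.
- exact: integral_ge0.
by rewrite lte_mul_pinfty// ?integral_ge0// ge0_fin_numE// integral_ge0.
Qed.

Lemma Rintegral_tensor (f : T1 -> R) (g : T2 -> R) :
  m1.-integrable setT (EFin \o f) -> m2.-integrable setT (EFin \o g) ->
  Rintegral (m1 \x m2)%E setT (fun z => f z.1 * g z.2)
  = Rintegral m1 setT f * Rintegral m2 setT g.
Proof.
move=> fi gi; have fgi := integrable_tensor fi gi.
rewrite /Rintegral -(integral12_prod_meas1 fgi)/= /fubini_F/=.
have -> : (\int[m1]_x \int[m2]_y (f x * g y)%:E =
           \int[m1]_x ((f x)%:E * \int[m2]_y (g y)%:E))%E.
  apply: eq_integral => x _; under eq_integral do rewrite EFinM.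
  by rewrite integralZl.
have gfin := integrable_fin_num measurableT gi.
rewrite -(fineK gfin) integralZr// fineM//.
exact: (integrable_fin_num measurableT fi).
Qed.

End TensorIntegral.

Lemma prod_ord3 (R : comRingType) (F : 'I_3 -> R) :
  \prod_i F i = F ord0 * F (inord 1) * F (inord 2).
Proof.
rewrite !big_ord_recl big_ord0 mulr1 mulrA.
have -> : lift ord0 ord0 = inord 1 :> 'I_3 by apply: val_inj; rewrite /= inordK.
by have -> : lift ord0 (lift ord0 ord0) = inord 2 :> 'I_3 by apply: val_inj; rewrite /= inordK.
Qed.

Lemma prod_proj3 (T : Type) (R : comRingType) (f : 'I_3 -> T -> R) (x : T * T * T) :
  \prod_i f i (proj3 x i) = f ord0 x.1.1 * f (inord 1) x.1.2 * f (inord 2) x.2.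
Proof. by rewrite prod_ord3 /proj3 /= !inordK. Qed.

Lemma measurable_tensor3 d (T : measurableType d) (R : realType) (f : 'I_3 -> T -> R) :
  (forall i, measurable_fun setT (f i)) ->
  measurable_fun setT (fun x : T * T * T => \prod_i f i (proj3 x i)).
Proof.
move=> mf; under eq_fun do rewrite prod_proj3.
have m1 : measurable_fun setT (fun x : T * T * T => x.1) by exact: measurable_fst.
apply: measurable_funM; first apply: measurable_funM.
- by apply: measurableT_comp => //; apply: (measurableT_comp _ m1); exact: measurable_fst.
- by apply: measurableT_comp => //; apply: (measurableT_comp _ m1); exact: measurable_snd.
- by apply: measurableT_comp => //; exact: measurable_snd.
Qed.

Section ProductMeasures.
Variable R : realType.
Let leb := @lebesgue_measure R.

Lemma mu3_tensor (f : 'I_3 -> R -> R) : (forall i, leb.-integrable setT (EFin \o f i)) ->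
  (mu3 R).-integrable setT (EFin \o (fun x : R3 R => \prod_i f i (proj3 x i))) /\
  Rintegral (mu3 R) setT (fun x : R3 R => \prod_i f i (proj3 x i)) =
  \prod_i Rintegral leb setT (f i).
Proof.
move=> fi.
have i2 : (mu2 R).-integrable setT (EFin \o (fun z => f ord0 z.1 * f (inord 1) z.2)).
  exact: (@integrable_tensor _ _ _ _ R leb leb _ _ (fi ord0) (fi (inord 1))).
have r2 : Rintegral (mu2 R) setT (fun z => f ord0 z.1 * f (inord 1) z.2) = _ :=
  @Rintegral_tensor _ _ _ _ R leb leb _ _ (fi ord0) (fi (inord 1)).
have i3 : (mu3 R).-integrable setT (EFin \o (fun z => f ord0 z.1.1 * f (inord 1) z.1.2 * f
  (inord 2) z.2)).
  exact: (@integrable_tensor _ _ _ _ R (mu2 R) leb _ _ i2 (fi (inord 2))).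
have r3 : Rintegral (mu3 R) setT (fun z => f ord0 z.1.1 * f (inord 1) z.1.2 * f (inord 2) z.2) =
  _ :=
  @Rintegral_tensor _ _ _ _ R (mu2 R) leb _ _ i2 (fi (inord 2)).
have -> : (fun x : R3 R => \prod_i f i (proj3 x i)) =
  (fun x => f ord0 x.1.1 * f (inord 1) x.1.2 * f (inord 2) x.2).
  by apply/funext => x; rewrite prod_proj3.
by split => //; rewrite r3 r2 prod_ord3.
Qed.

Lemma mu9_tensor3 (g : 'I_3 -> R3 R -> R) : (forall i, (mu3 R).-integrable setT (EFin \o g i)) ->
  (mu9 R).-integrable setT (EFin \o (fun x : R9 R => \prod_i g i (proj3 x i))) /\
  Rintegral (mu9 R) setT (fun x : R9 R => \prod_i g i (proj3 x i)) =
  \prod_i Rintegral (mu3 R) setT (g i).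
Proof.
move=> gi.
have i2 : (mu6 R).-integrable setT (EFin \o (fun z => g ord0 z.1 * g (inord 1) z.2)).
  exact: (@integrable_tensor _ _ _ _ R (mu3 R) (mu3 R) _ _ (gi ord0) (gi (inord 1))).
have r2 : Rintegral (mu6 R) setT (fun z => g ord0 z.1 * g (inord 1) z.2) = _ :=
  @Rintegral_tensor _ _ _ _ R (mu3 R) (mu3 R) _ _ (gi ord0) (gi (inord 1)).
have i3 : (mu9 R).-integrable setT (EFin \o (fun z => g ord0 z.1.1 * g (inord 1) z.1.2 * g
  (inord 2) z.2)).
  exact: (@integrable_tensor _ _ _ _ R (mu6 R) (mu3 R) _ _ i2 (gi (inord 2))).
have r3 : Rintegral (mu9 R) setT (fun z => g ord0 z.1.1 * g (inord 1) z.1.2 * g (inord 2) z.2) =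
  _ :=
  @Rintegral_tensor _ _ _ _ R (mu6 R) (mu3 R) _ _ i2 (gi (inord 2)).
have -> : (fun x : R9 R => \prod_i g i (proj3 x i)) =
  (fun x => g ord0 x.1.1 * g (inord 1) x.1.2 * g (inord 2) x.2).
  by apply/funext => x; rewrite prod_proj3.
by split => //; rewrite r3 r2 prod_ord3.
Qed.

Lemma prod_coord9 (f : idx9 -> R -> R) (x : R9 R) :
  \prod_p f p (coord9 x p) = \prod_i \prod_j f (i, j) (proj3 (proj3 x i) j).
Proof. by rewrite pair_bigA; apply: eq_bigr => -[i j]. Qed.

Lemma mu9_tensor (f : idx9 -> R -> R) : (forall p, leb.-integrable setT (EFin \o f p)) ->
  (mu9 R).-integrable setT (EFin \o (fun x : R9 R => \prod_p f p (coord9 x p))) /\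
  Rintegral (mu9 R) setT (fun x : R9 R => \prod_p f p (coord9 x p)) =
  \prod_p Rintegral leb setT (f p).
Proof.
move=> fi; pose g i y := \prod_j f (i, j) (proj3 y j).
have h i := mu3_tensor (fun j => fi (i, j)).
have [ig rg] := @mu9_tensor3 g (fun i => (h i).1).
rewrite (_ : (fun x : R9 R => _) = fun x : R9 R => \prod_i g i (proj3 x i)); last first.
  by apply/funext => x; exact: prod_coord9.
split => //; rewrite rg; under eq_bigr do rewrite (h _).2.
by rewrite pair_bigA; apply: eq_bigr => -[i j].
Qed.

Lemma measurable_tensor9 (f : idx9 -> R -> R) :
  (forall p, measurable_fun [set: measurableTypeR R] (f p)) ->
  measurable_fun [set: meas9 R] (fun x : R9 R => \prod_p f p (coord9 x p)).
Proof.
move=> mf; under eq_fun do rewrite prod_coord9.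
apply: (@measurable_tensor3 _ (meas3 R) R (fun i y => \prod_j f (i, j) (proj3 y j))) => i.
exact: (@measurable_tensor3 _ (measurableTypeR R) R (fun j => f (i, j)) (fun j => mf (i, j))).
Qed.

(** With [s = sqrt 3] these are the eigenfunctions of the diagonal kernel; with [s = 1] they serve
    as majorants. *)
Definition dilated_hermite3 (s : R) (b : 'I_3 -> nat) (x : R3 R) : R :=
  \prod_j hermite_fun (b j) (s * proj3 x j).

Lemma dilated_hermite3_orthogonal s (b c : 'I_3 -> nat) : 0 < s ->
  inner (mu3 R) (dilated_hermite3 s b) (dilated_hermite3 s c) =
  [forall j, b j == c j]%:R / s ^+ 3.
Proof.
move=> s0.
have [_ hE] := @mu3_tensor (fun j y => hermite_fun (b j) (s * y) * hermite_fun (c j) (s * y))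
  (fun j => integrable_hermite_funM (b j) (c j) s0).
rewrite /inner; under eq_Rintegral do rewrite /dilated_hermite3 -big_split/=.
rewrite hE; under eq_bigr do rewrite hermite_fun_orthonormal//.
rewrite big_split/= prodr_const card_ord -exprVn; congr (_ * _).
case: (boolP [forall j, b j == c j]) => [/forallP bc|/forallPn[j bc]].
  by rewrite big1// => j _; rewrite bc.
by rewrite (bigD1 j)//= (negbTE bc) mul0r.
Qed.

Lemma sqint_dilated_hermite3 s (b : 'I_3 -> nat) : 0 < s -> sqint (mu3 R) (dilated_hermite3 s b).
Proof.
move=> s0; split.
  apply: (@measurable_tensor3 _ (measurableTypeR R) R (fun j y => hermite_fun (b j) (s * y))) =>
    j.
  by apply: measurableT_comp; [exact: measurable_hermite_fun|exact: measurable_funM].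
have [h _] := @mu3_tensor (fun j y => hermite_fun (b j) (s * y) * hermite_fun (b j) (s * y))
  (fun j => integrable_hermite_funM (b j) (b j) s0).
under eq_integral do rewrite expr2 /dilated_hermite3 -big_split/=.
exact: (integrable_lty measurableT h).
Qed.

Let hermite_funM1 n m : (fun y : R => hermite_fun n (1 * y) * hermite_fun m (1 * y)) =
  (fun y => hermite_fun n y * hermite_fun m y).
Proof. by apply/funext => y; rewrite mul1r. Qed.

Let integrable_hermite_fun1 n m :
  leb.-integrable setT (EFin \o (fun y : R => hermite_fun n y * hermite_fun m y)).
Proof. by rewrite -hermite_funM1; exact: integrable_hermite_funM. Qed.

Lemma hermite9_orthonormal (a b : multiindex) :
  inner (mu9 R) (@hermite9 R a) (@hermite9 R b) = [forall p, a p == b p]%:R.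
Proof.
have [_ hE] := @mu9_tensor (fun p y => hermite_fun (a p) y * hermite_fun (b p) y)
  (fun p => integrable_hermite_fun1 (a p) (b p)).
rewrite /inner; under eq_Rintegral do rewrite /hermite9 -big_split/=.
rewrite hE; under eq_bigr do rewrite -hermite_funM1 hermite_fun_orthonormal// divr1.
case: (boolP [forall p, a p == b p]) => [/forallP ab|/forallPn[p ab]].
  by rewrite big1// => p _; rewrite ab.
by rewrite (bigD1 p)//= (negbTE ab) mul0r.
Qed.

Lemma sqint_hermite9 (a : multiindex) : sqint (mu9 R) (@hermite9 R a).
Proof.
split.
  by apply: (@measurable_tensor9 (fun p => @hermite_fun R (a p))) => p;
    exact: measurable_hermite_fun.
have [h _] := @mu9_tensor (fun p y => hermite_fun (a p) y * hermite_fun (a p) y)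
  (fun p => integrable_hermite_fun1 (a p) (a p)).
under eq_integral do rewrite expr2 /hermite9 -big_split/=.
exact: (integrable_lty measurableT h).
Qed.

End ProductMeasures.

(** * Hermite functions as Schwartz eigenfunctions *)

Section TensorDerivatives.
Variable R : realType.
Implicit Types (q : {poly R}) (Q : idx9 -> {poly R}) (x v : R9 R) (y h : R) (p : idx9).

(** Hermite's equation, obtained by differentiating the defining recursion for [H_(n+1)] and
    comparing with [deriv_hermite]. *)
Lemma hermite_ode n :
  (hermite_poly R n)^`()^`() = 2%:R *: ('X * (hermite_poly R n)^`()) - (2 * n)%N%:R *:
    hermite_poly R n.
Proof.
have := deriv_hermite R n; rewrite hermiteS derivB derivZ derivM derivX mul1r scalerDr.
move=> /eqP; rewrite subr_eq => /eqP E.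
have -> : (hermite_poly R n)^`()^`() = (2 * n.+1)%N%:R *: hermite_poly R n
   + (hermite_poly R n)^`()^`() - (2 * n.+1)%N%:R *: hermite_poly R n by rewrite addrAC subrr
     add0r.
rewrite -E -!mul_polyC mulnS natrD polyCD; ring.
Qed.

Definition gauss1 q y : R := q.[y] * expR (- (y ^+ 2 / 2)).

(** Differentiation conjugated by [e^(-y^2/2)], so that derivatives of [gauss1 q] stay in the same
    class. *)
Definition dgauss q : {poly R} := q^`() - 'X * q.

Lemma is_derive_gauss1 q y : is_derive y (1 : R) (gauss1 q) (gauss1 (dgauss q) y).
Proof.
rewrite (_ : gauss1 q = horner q * (expR \o (- (2^-1 \*o (id ^+ 2))))); last first.
  by apply/funext => z; rewrite /gauss1 /= [_ / 2]mulrC.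
have hq := is_derive_horner q y.
apply: is_derive_eq => /=.
rewrite (_ : (- _) y = - (y ^+ 2 / 2)); last by rewrite mulrC.
by rewrite /gauss1 /dgauss /GRing.scale /= !hornerE/=; field.
Qed.

Lemma gauss1_bound q k : exists M : R, forall y, (1 + y ^+ 2) ^+ k * `|gauss1 q y| <= M.
Proof.
have [|M M0 HM] := @poly_growth R ((1 + 'X^2) ^+ k * q) (1 / 2); first by rewrite divr_gt0.
exists M => y; have y0 : 0 <= 1 + y ^+ 2 by rewrite addr_ge0 ?sqr_ge0.
rewrite normrM [X in _ * (_ * X)]ger0_norm ?expR_ge0// expRN mulrA.
rewrite ler_pdivrMr ?expR_gt0//; have := HM y.
rewrite hornerM horner_exp hornerD hornerXn hornerC normrM ger0_norm ?exprn_ge0//.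
by rewrite mul1r [2^-1 * _]mulrC.
Qed.

(** A class that contains every [hermite9 a] and is stable under all partial derivatives; the
    Schwartz property needs to be checked on it only once. *)
Definition tensor Q x : R := \prod_p gauss1 (Q p) (coord9 x p).

Lemma proj3_mk3 (T : Type) (f : 'I_3 -> T) i : proj3 (mk3 f) i = f i.
Proof.
by rewrite /proj3 /mk3; case: i => [[|[|[|//]]]] i3 /=; congr f; apply: val_inj;
  rewrite /= inordK.
Qed.

Lemma coord9_basis p p' : coord9 (basis9 R p) p' = (p' == p)%:R.
Proof. by rewrite /coord9 /basis9 !proj3_mk3 -surjective_pairing. Qed.

Lemma coord9_scaleD h v x p : coord9 (h *: v + x) p = h * coord9 v p + coord9 x p.
Proof.
by case: p => -[[|[|[|//]]] i3] -[[|[|[|//]]] j3].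
Qed.

Definition update Q p : idx9 -> {poly R} := fun p' => if p' == p then dgauss (Q p') else Q p'.

Lemma tensor_shift Q p x h : tensor Q (h *: basis9 R p + x) =
  (\prod_(p' | p' != p) gauss1 (Q p') (coord9 x p')) * gauss1 (Q p) (h + coord9 x p).
Proof.
rewrite /tensor (bigD1 p)//= mulrC coord9_scaleD coord9_basis eqxx mulr1; congr (_ * _).
by apply: eq_bigr => p' pp'; rewrite coord9_scaleD coord9_basis (negbTE pp') mulr0 add0r.
Qed.

(** Along a basis vector only one factor varies, so the difference quotient is a constant times a
    one-variable one. *)
Lemma tensor_derivative Q p x :
  derivable (tensor Q) x (basis9 R p) /\ 'D_(basis9 R p) (tensor Q) x = tensor (update Q p) x.
Proof.
set C := \prod_(p' | p' != p) gauss1 (Q p') (coord9 x p').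
have quot : (fun h => h^-1 *: ((tensor Q \o shift x) (h *: basis9 R p) - tensor Q x)) =
    (fun h => C * (h^-1 *: ((gauss1 (Q p) \o shift (coord9 x p)) (h *: (1 : R)) - gauss1 (Q p)
      (coord9 x p)))).
  apply/funext => h; rewrite /= tensor_shift.
  have -> : tensor Q x = C * gauss1 (Q p) (coord9 x p).
    by have := tensor_shift Q p x 0; rewrite scale0r !add0r.
  by rewrite /GRing.scale /= mulr1 -mulrBr mulrCA.
have dG := is_derive_gauss1 (Q p) (coord9 x p).
have cG : ((fun h => h^-1 *: ((gauss1 (Q p) \o shift (coord9 x p)) (h *: (1 : R)) - gauss1 (Q p)
  (coord9 x p)))
    @ 0^' --> gauss1 (dgauss (Q p)) (coord9 x p))%classic.
  have := @ex_derive _ _ _ _ _ _ _ dG; rewrite -[X in (_ --> X)%classic](@derive_val _ _ _ _ _ _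
    _ dG).
  exact.
have cT : ((fun h => h^-1 *: ((tensor Q \o shift x) (h *: basis9 R p) - tensor Q x)) @ 0^' -->
    tensor (update Q p) x)%classic.
  have -> : tensor (update Q p) x = C * gauss1 (dgauss (Q p)) (coord9 x p).
    rewrite /tensor (bigD1 p)//= mulrC /update eqxx; congr (_ * _).
    by apply: eq_bigr => p' pp'; rewrite (negbTE pp').
  by rewrite quot; apply: cvgMr.
by split; [exact: cvgP cT|exact: cvg_lim cT].
Qed.

Lemma iter_partial_tensor l Q : exists Q', iter_partial l (tensor Q) = tensor Q'.
Proof.
elim: l => [|p l [Q' E]]; first by exists Q.
exists (update Q' p); rewrite /= -/(iter_partial l (tensor Q)) E.
by apply/funext => x; exact: (tensor_derivative Q' p x).2.
Qed.

(** Bounds the weight [1 + |x|^2] by a product over the coordinates, which splits the Schwartz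
    seminorms of a tensor into one-variable ones. *)
Lemma ler_1Dsum_prod (I : finType) (a : I -> R) : (forall i, 0 <= a i) ->
  1 + \sum_i a i <= \prod_i (1 + a i).
Proof.
move=> a0; elim: (index_enum I) => [|i s IH]; first by rewrite !big_nil addr0.
rewrite !big_cons; have s0 : 0 <= \sum_(j <- s) a j by exact: sumr_ge0.
by apply: le_trans (ler_wpM2l _ IH); have := a0 i; nra.
Qed.

Lemma schwartz_tensor Q : schwartz (tensor Q).
Proof.
move=> l; have [{}Q ->] := iter_partial_tensor l Q; split.
  by move=> p x; exact: (tensor_derivative Q p x).1.
move=> k; have /choice[M HM] := fun p => gauss1_bound (Q p) k.
exists (\prod_p M p) => x; rewrite /tensor normr_prod.
apply: (@le_trans _ _ (\prod_p ((1 + coord9 x p ^+ 2) ^+ k * `|gauss1 (Q p) (coord9 x p)|))).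
  rewrite big_split/= ler_wpM2r ?prodr_ge0// prodrXl.
  apply: lerXn2r; rewrite ?nnegrE ?addr_ge0 ?sumr_ge0 ?prodr_ge0// => *;
    rewrite ?addr_ge0 ?sqr_ge0//.
  by apply: ler_1Dsum_prod => p; exact: sqr_ge0.
by apply: ler_prod => p _; rewrite HM mulr_ge0 ?exprn_ge0 ?addr_ge0 ?sqr_ge0.
Qed.

Definition hermite_poly1 n : {poly R} :=
  (Num.sqrt (2 ^+ n * n`!%:R * Num.sqrt pi))^-1 *: hermite_poly R n.

Lemma hermite9_tensor (a : multiindex) : @hermite9 R a = tensor (fun p => hermite_poly1 (a p)).
Proof.
by apply/funext => x; apply: eq_bigr => p _; rewrite /hermite_fun /gauss1 hornerZ.
Qed.

Lemma dgauss2_hermite n : dgauss (dgauss (hermite_poly1 n)) =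
  ('X^2 - ((2 * n + 1)%N%:R)%:P) * hermite_poly1 n.
Proof.
rewrite /dgauss /hermite_poly1; set c := _^-1; rewrite derivZ derivB derivZ derivM derivX derivZ
  hermite_ode.
rewrite -!mul_polyC natrD polyCD polyC1; ring.
Qed.

Lemma hermite_op_hermite9 (a : multiindex) :
  hermite_op (@hermite9 R a) = (fun x => eigenvalue9 R a * hermite9 a x).
Proof.
pose Q p : {poly R} := hermite_poly1 (a p).
apply/funext => x; rewrite hermite9_tensor /hermite_op /laplacian -/Q.
have D2 p : 'D_(basis9 R p) ('D_(basis9 R p) (tensor Q)) x =
    (coord9 x p ^+ 2 - (2 * a p + 1)%N%:R) * tensor Q x.
  have -> : 'D_(basis9 R p) (tensor Q) = tensor (update Q p).
    by apply/funext => z; exact: (tensor_derivative Q p z).2.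
  rewrite (tensor_derivative _ p x).2 /tensor (bigD1 p)//= [in RHS](bigD1 p)//= mulrA;
    congr (_ * _).
    by rewrite /update eqxx /Q dgauss2_hermite /gauss1 hornerM hornerD hornerN hornerXn hornerC
      mulrA.
  by apply: eq_bigr => p' pp'; rewrite /update (negbTE pp').
under eq_bigr do rewrite D2.
(* The quadratic terms cancel against [|x|^2], and the constants [2 a_p + 1] add up to
   [2 |a| + 9]. *)
rewrite -mulr_suml sumrB /sqnorm9 mulrBl opprB subrK; congr (_ * _).
rewrite /eigenvalue9 -natr_sum; congr (_%:R).
by rewrite /deg big_split/= -big_distrr/= sum1_card card_prod !card_ord.
Qed.

End TensorDerivatives.

(** * Restriction of an eigenspace to the diagonal *)

Section DegreeSlices.
Variable V : nmodType.
Implicit Type F : multiindex -> V.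

(** Entries are bounded by the degree [k] itself, so the slice does not depend on the truncation of
    the sum it is cut from. *)
Definition deg_slice k F : V :=
  \sum_(a : {ffun idx9 -> 'I_k.+1} | deg (fun p => a p) == k) F (fun p => a p).

Lemma leq_deg (a : multiindex) p : (a p <= deg a)%N.
Proof. by rewrite /deg (bigD1 p)//= leq_addr. Qed.

Lemma deg_slice_widen N k F : (k <= N)%N ->
  \sum_(a : {ffun idx9 -> 'I_N.+1} | deg (fun p => a p) == k) F (fun p => a p) = deg_slice k F.
Proof.
move=> kN.
pose h (b : {ffun idx9 -> 'I_k.+1}) : {ffun idx9 -> 'I_N.+1} :=
  [ffun p => widen_ord (n:=k.+1) (m:=N.+1) kN (b p)].
pose h' (a : {ffun idx9 -> 'I_N.+1}) : {ffun idx9 -> 'I_k.+1} := [ffun p => inord (a p)].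
have hE b : (fun p => h b p : nat) = (fun p => b p : nat) by apply/funext => p; rewrite ffunE.
rewrite (reindex_onto h h') => [|a /eqP da]; last first.
  apply/ffunP => p; rewrite !ffunE; apply: val_inj; rewrite /= inordK// ltnS -da.
  exact: (leq_deg (fun p => a p)).
apply: eq_big => [b|b _]; rewrite hE//.
rewrite andb_idr// => _; apply/eqP/ffunP => p; rewrite !ffunE; apply: val_inj.
by rewrite /= inordK.
Qed.

Lemma sum_deg_slice N F :
  \sum_(a : {ffun idx9 -> 'I_N.+1} | (deg (fun p => a p) <= N)%N) F (fun p => a p)
  = \sum_(k < N.+1) deg_slice k F.
Proof.
rewrite (partition_big (fun a : {ffun idx9 -> 'I_N.+1} => inord (deg (fun p => a p)) : 'I_N.+1)
  xpredT)//=.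
apply: eq_bigr => k _; rewrite -(deg_slice_widen (N := N)); last by rewrite -ltnS.
apply: eq_bigl => a; apply/andP/eqP => [[aN /eqP <-]|aE]; first by rewrite inordK.
by rewrite aE -ltnS; split => //; apply/eqP; apply: val_inj; rewrite /= inordK.
Qed.

End DegreeSlices.

Section DiagonalRestriction.
Variable R : realType.
Implicit Types (a : multiindex) (x y : R3 R).

Lemma coord9_diag x p : coord9 (diag9 x) p = proj3 x p.2.
Proof. by case: p => -[[|[|[|//]]] i3] j. Qed.

Let s3 : 0 < sqrt3 R. Proof. by rewrite sqrtr_gt0. Qed.

Lemma hermite_fun_bounded n : exists M : R, forall y : R, `|hermite_fun n y| <= M.
Proof.
have [M HM] := gauss1_bound (hermite_poly1 R n) 0; exists M => y.
by have := HM y; rewrite expr0 mul1r /gauss1 /hermite_poly1 hornerZ.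
Qed.

(** On the diagonal each coordinate of R^3 carries three Hermite functions: two are bounded by
    constants, the third keeps the square integrability. *)
Lemma sqint_hermite9_diag a : sqint (mu3 R) (fun x => hermite9 a (diag9 x)).
Proof.
pose b j := a (ord0, j).
have /choice[M HM] : forall n, exists M : R, forall y : R, `|hermite_fun n y| <= M by exact:
  hermite_fun_bounded.
have E x : hermite9 a (diag9 x) = \prod_j \prod_i hermite_fun (a (i, j)) (proj3 x j).
  rewrite /hermite9; under eq_bigr do rewrite coord9_diag.
  by rewrite exchange_big pair_bigA; apply: eq_bigr => -[i j].
apply: (@sqint_le _ (meas3 R) R (mu3 R) _ (dilated_hermite3 1 b)
  (\prod_j (M (a (inord 1, j)) * M (a (inord 2, j))))).
- rewrite (_ : (fun x => _) = fun x : R3 R => \prod_j \prod_i hermite_fun (a (i, j)) (proj3 x j)).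
    apply: (@measurable_tensor3 _ (measurableTypeR R) R
      (fun j (y : R) => \prod_i hermite_fun (a (i, j)) y)) => j.
    under eq_fun do rewrite prod_ord3.
    by apply: measurable_funM; [apply: measurable_funM|]; exact: (@measurable_hermite_fun R _).
  by apply/funext => x; exact: E.
- exact: sqint_dilated_hermite3.
move=> x; rewrite E !normr_prod -big_split/=.
apply: ler_prod => j _; rewrite normr_ge0 prod_ord3 mul1r /=.
have h1 := HM (a (inord 1, j)) (proj3 x j); have h2 := HM (a (inord 2, j)) (proj3 x j).
rewrite /b; move: (hermite_fun (a (ord0, j)) _) => u.
move: (hermite_fun _ _) h1 (hermite_fun _ _) h2 => v h1 w h2.
by rewrite !normrM -mulrA mulrC ler_wpM2r// ler_pM.
Qed.

Definition gauss_weight (x y : R) : R :=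
  expR (- (x ^+ 2 / 2)) * expR (- (y ^+ 2 / 2)) / Num.sqrt pi.

Lemma hermite_fun_mehler n (x y : R) :
  hermite_fun n x * hermite_fun n y = mehler_coef x y n * gauss_weight x y.
Proof.
rewrite /hermite_fun /mehler_coef /gauss_weight; set c := 2 ^+ n * n`!%:R.
have c0 : 0 < c by rewrite mulr_gt0 ?exprn_gt0 ?ltr0n ?fact_gt0.
have p0 : 0 < Num.sqrt pi :> R by rewrite sqrtr_gt0 pi_gt0.
transitivity ((Num.sqrt (c * Num.sqrt pi) ^+ 2)^-1 * (hermite_poly R n).[x] *
  (hermite_poly R n).[y] * (expR (- (x ^+ 2 / 2)) * expR (- (y ^+ 2 / 2)))).
  by rewrite -exprVn; ring.
rewrite sqr_sqrtr ?mulr_ge0 ?ltW//; field.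
by rewrite !gt_eqF.
Qed.

(** The origin of [sqrt 3]: cubing triples the exponent, and [pi^(-3/2)] leaves a factor [1 / pi]
    beside the normalisation of the dilated weight. *)
Lemma gauss_weight_dilation (x y : R) :
  gauss_weight x y ^+ 3 = pi^-1 * gauss_weight (sqrt3 R * x) (sqrt3 R * y).
Proof.
have p0 : 0 < Num.sqrt pi :> R by rewrite sqrtr_gt0 pi_gt0.
have e3 (z : R) : expR (- ((sqrt3 R * z) ^+ 2 / 2)) = expR (- (z ^+ 2 / 2)) ^+ 3.
  rewrite -expRM_natl exprMn sqr_sqrtr ?ler0n//; congr expR; ring.
rewrite /gauss_weight !e3 -[X in X^-1 * _](@sqr_sqrtr _ pi) ?pi_ge0//; field.
by rewrite gt_eqF.
Qed.

Lemma diagonal_kernel k x y :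
  \sum_(a : {ffun idx9 -> 'I_k.+1} | deg (fun p => a p) == k)
     hermite9 (fun p => a p) (diag9 x) * hermite9 (fun p => a p) (diag9 y) =
  \sum_(b : {ffun 'I_3 -> 'I_k.+1}) kernel_weight R k b / pi ^+ 3 *
     (dilated_hermite3 (sqrt3 R) (fun j => b j) x * dilated_hermite3 (sqrt3 R) (fun j => b j) y).
Proof.
pose G := \prod_j gauss_weight (proj3 x j) (proj3 y j) ^+ 3.
transitivity (G * \sum_(a : {ffun idx9 -> 'I_k.+1} | (\sum_p a p == k)%N)
    \prod_p mehler_coef (proj3 x p.2) (proj3 y p.2) (a p)).
  rewrite mulr_sumr; apply: eq_bigr => a _.
  have -> : G = \prod_(p : idx9) gauss_weight (proj3 x p.2) (proj3 y p.2).
    rewrite -(pair_bigA _ (fun _ j : 'I_3 => gauss_weight (proj3 x j) (proj3 y j)))/=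
      exchange_big/=.
    by apply: eq_bigr => j _; rewrite prodr_const card_ord.
  rewrite /hermite9 -!big_split/=; apply: eq_bigr => p _.
  by rewrite !coord9_diag hermite_fun_mehler mulrC.
rewrite mehler_kernel// mulr_sumr; apply: eq_bigr => b _.
rewrite mulrCA -[RHS]mulrA; congr (_ * _).
rewrite /dilated_hermite3 -[in RHS]big_split/=.
have -> : (pi ^+ 3)^-1 = \prod_(j < 3) pi^-1 :> R by rewrite prodr_const card_ord exprVn.
rewrite -!big_split/=; apply: eq_bigr => j _.
by rewrite hermite_fun_mehler gauss_weight_dilation; ring.
Qed.

(** [pi^(-3)] is one [1 / pi] from [gauss_weight_dilation] per coordinate of R^3; [sqrt 3 ^ (-3)] is
    the squared norm of the dilated Hermite functions. *)
Definition diag_const : R := (pi ^+ 3)^-1 * (sqrt3 R ^+ 3)^-1.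

Lemma diag_const_gt0 : 0 < diag_const.
Proof. by rewrite mulr_gt0 ?invr_gt0 ?exprn_gt0 ?pi_gt0. Qed.

Definition diag_slice k (c : multiindex -> R) x : R :=
  deg_slice k (fun a => c a * hermite9 a (diag9 x)).

Lemma sqint_diag_slice k c : sqint (mu3 R) (diag_slice k c).
Proof. by apply: sqint_sum => a; exact: sqint_hermite9_diag. Qed.

Lemma diagonal_bound k (c : multiindex -> R) :
  inner (mu3 R) (diag_slice k c) (diag_slice k c) <=
  diag_const * k.+1%:R ^+ 2 * deg_slice k (fun a => c a ^+ 2).
Proof.
have k0 : 0 < (sqrt3 R ^+ 3)^-1 by rewrite invr_gt0 exprn_gt0.
have p0 : 0 < (pi ^+ 3)^-1 :> R by rewrite invr_gt0 exprn_gt0 ?pi_gt0.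
have W0 : 0 < k.+1%:R ^+ 2 / pi ^+ 3 :> R by rewrite mulr_gt0// exprn_gt0// ltr0n.
have -> : diag_const * k.+1%:R ^+ 2 = k.+1%:R ^+ 2 / pi ^+ 3 * (sqrt3 R ^+ 3)^-1.
  by rewrite /diag_const; ring.
apply: (@kernel_bound _ (meas3 R) R (mu3 R) _ _
  (fun a : {ffun idx9 -> 'I_k.+1} => deg (fun p => a p) == k)
  (fun (a : {ffun idx9 -> 'I_k.+1}) x => hermite9 (fun p => a p) (diag9 x))
  (fun (b : {ffun 'I_3 -> 'I_k.+1}) x => dilated_hermite3 (sqrt3 R) (fun j => b j) x)
  (fun b => kernel_weight R k b / pi ^+ 3)) => //.
- by move=> a; exact: sqint_hermite9_diag.
- by move=> b; exact: sqint_dilated_hermite3.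
- move=> b b'; rewrite dilated_hermite3_orthogonal//; congr (_%:R * _); congr nat_of_bool.
  apply/forallP/eqP => [bb|-> //]; apply/ffunP => j; apply: val_inj; exact/eqP/bb.
- move=> b; case/andP: (kernel_weight_bounds R k b) => w0 w1.
  by rewrite divr_ge0 ?exprn_ge0 ?pi_ge0//= ler_wpM2r// ltW.
- exact: diagonal_kernel.
Qed.

End DiagonalRestriction.

(** * Hermite coefficients of the solution *)

Section HermiteCoefficients.
Variable R : realType.
Local Notation C := R[i].
Implicit Types (f g : R9 R -> C) (a b : multiindex) (t : R).
Local Notation Re := (@complex.Re R).
Local Notation Im := (@complex.Im R).

Lemma sqmod_ge0 (z : C) : 0 <= sqmod z.
Proof. by rewrite addr_ge0 ?sqr_ge0. Qed.

Lemma sqmod_eq0 (z : C) : sqmod z <= 0 -> z = 0.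
Proof.
case: z => x y; rewrite /sqmod /= => h.
have x0 : x ^+ 2 = 0 by apply/eqP; rewrite eq_le sqr_ge0 andbT; have := sqr_ge0 y; lra.
have y0 : y ^+ 2 = 0 by apply/eqP; rewrite eq_le sqr_ge0 andbT; have := sqr_ge0 x; lra.
by move/eqP: x0; move/eqP: y0; rewrite !sqrf_eq0 => /eqP -> /eqP ->.
Qed.

Lemma inL2_sqint f : inL2 f ->
  sqint (mu9 R) (fun x => Re (f x)) /\ sqint (mu9 R) (fun x => Im (f x)).
Proof.
move=> [[mr mi] foo]; have mf : measurable_fun [set: meas9 R] (fun x => (sqmod (f x))%:E).
  by apply/measurable_EFinP; apply: measurable_funD; apply: measurable_funX.
have h (F : R9 R -> R) : measurable_fun [set: meas9 R] F ->
    (forall x, F x ^+ 2 <= sqmod (f x)) -> sqint (mu9 R) F.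
  move=> mF Fle; split; first exact: mF.
  apply: (@le_lt_trans _ _ (\int[mu9 R]_x (sqmod (f x))%:E)%E); last exact: foo.
  apply: ge0_le_integral.
  - exact: measurableT.
  - by move=> x _; rewrite lee_fin sqr_ge0.
  - by apply/measurable_EFinP; apply: measurable_funX; exact: mF.
  - exact: mf.
  - by move=> x _; rewrite lee_fin Fle.
by split; apply: h => // x; rewrite /sqmod ?lerDl ?lerDr sqr_ge0.
Qed.

Lemma sqint_sqmod d (T : measurableType d) (mu : {measure set T -> \bar R}) (F : T -> C) :
  sqint mu (fun x => Re (F x)) -> sqint mu (fun x => Im (F x)) ->
  (\int[mu]_x (sqmod (F x))%:E)%E = (inner mu (fun x => Re (F x)) (fun x => Re (F x))
    + inner mu (fun x => Im (F x)) (fun x => Im (F x)))%:E.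
Proof.
move=> sr si; rewrite EFinD -!inner_integral// -ge0_integralD//.
- by move=> x _; rewrite lee_fin sqr_ge0.
- by apply/measurable_EFinP; apply: measurable_funX; exact: sr.1.
- by move=> x _; rewrite lee_fin sqr_ge0.
- by apply/measurable_EFinP; apply: measurable_funX; exact: si.1.
Qed.

Lemma sqnormL2E f : inL2 f ->
  sqnormL2 f = (inner (mu9 R) (fun x => Re (f x)) (fun x => Re (f x))
    + inner (mu9 R) (fun x => Im (f x)) (fun x => Im (f x)))%:E.
Proof. by move=> /inL2_sqint[sr si]; exact: (@sqint_sqmod _ _ (mu9 R)). Qed.

Lemma Re_coef f a : Re (hermite_coef f a) = inner (mu9 R) (fun x => Re (f x)) (hermite9 a).
Proof. by []. Qed.

Lemma Im_coef f a : Im (hermite_coef f a) = inner (mu9 R) (fun x => Im (f x)) (hermite9 a).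
Proof. by []. Qed.

Let e_orth N (a b : {ffun idx9 -> 'I_N.+1}) :
  inner (mu9 R) (hermite9 (fun p => a p)) (hermite9 (fun p => b p)) = (a == b)%:R * 1.
Proof.
rewrite hermite9_orthonormal mulr1; congr (_%:R); congr nat_of_bool.
by apply/forallP/eqP => [ab|-> //]; apply/ffunP => j; apply: val_inj; exact/eqP/ab.
Qed.

Lemma bessel_coef g n : inL2 g ->
  ((\sum_(k < n) deg_slice k (fun a => sqmod (hermite_coef g a)))%:E <= sqnormL2 g)%E.
Proof.
move=> g2; have [sr si] := inL2_sqint g2; rewrite sqnormL2E// lee_fin.
case: n => [|N]; first by rewrite big_ord0 addr_ge0// inner_ge0.
rewrite -(sum_deg_slice N (fun a => sqmod (hermite_coef g a))).
have B h : sqint (mu9 R) h -> \sum_(a : {ffun idx9 -> 'I_N.+1} | (deg (fun p => a p) <= N)%N)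
    inner (mu9 R) h (hermite9 (fun p => a p)) ^+ 2 <= inner (mu9 R) h h.
  move=> sh; rewrite -[leRHS]mul1r.
  apply: (@bessel _ _ _ (mu9 R) _ _ (fun a : {ffun idx9 -> 'I_N.+1} => hermite9 (fun p => a p)))
    => //.
  by move=> a; exact: sqint_hermite9.
apply: le_trans (lerD (B _ sr) (B _ si)); rewrite -big_split/=.
by apply: ler_sum => a _; rewrite /sqmod Re_coef Im_coef.
Qed.

(** The weak equation is tested against [hermite9 a], a Schwartz function and an eigenfunction of
    [hermite_op]. *)
Lemma sqmod_coef_weak f g a : inL2 f -> weak_hermite_op f g ->
  sqmod (hermite_coef g a) = eigenvalue9 R a ^+ 2 * sqmod (hermite_coef f a).
Proof.
move=> /inL2_sqint[sr si] /(_ (hermite9 a)) fg; rewrite [hermite_coef g a]/hermite_coef -fg;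
  last first.
  by rewrite hermite9_tensor; exact: schwartz_tensor.
have E h : sqint (mu9 R) h -> Rintegral (mu9 R) setT (fun x => h x * hermite_op (hermite9 a) x)
    = eigenvalue9 R a * inner (mu9 R) h (hermite9 a).
  move=> sh; rewrite hermite_op_hermite9 -(@RintegralZl _ _ _ (mu9 R))//; last first.
    by apply: sqint_integrableM => //; exact: sqint_hermite9.
  by apply: eq_Rintegral => x _; rewrite mulrCA.
rewrite /sqmod Re_coef Im_coef.
have -> : Re (pairing f (hermite_op (hermite9 a))) = _ := E _ sr.
have -> : Im (pairing f (hermite_op (hermite9 a))) = _ := E _ si.
ring.
Qed.

Lemma Re_sum (I : Type) (s : seq I) (P : pred I) (F : I -> C) :
  Re (\sum_(i <- s | P i) F i) = \sum_(i <- s | P i) Re (F i).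
Proof. exact: raddf_sum. Qed.

Lemma Im_sum (I : Type) (s : seq I) (P : pred I) (F : I -> C) :
  Im (\sum_(i <- s | P i) F i) = \sum_(i <- s | P i) Im (F i).
Proof. exact: raddf_sum. Qed.

Lemma Re_mul_real (z : C) (r : R) : Re (z * (r%:C)%C) = Re z * r.
Proof. by case: z => x y /=; rewrite mulr0 subr0. Qed.

Lemma Im_mul_real (z : C) (r : R) : Im (z * (r%:C)%C) = Im z * r.
Proof. by case: z => x y /=; rewrite mulr0 add0r. Qed.

(** For [N >= deg a] the difference of the two sides is the coefficient at [a] of
    [u t - evolution_sum N f t], hence bounded by the norm of that function, which tends to 0. *)
Lemma coef_solution f u t a : inL2 f -> schrodinger_solution f u ->
  hermite_coef (u t) a = expNi (t * eigenvalue9 R a) * hermite_coef f a.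
Proof.
move=> f2 /(_ t)[u2 uc]; have [ur ui] := inL2_sqint u2.
pose z b := expNi (t * eigenvalue9 R b) * hermite_coef f b.
apply/eqP; rewrite -subr_eq0; apply/eqP/sqmod_eq0; rewrite -/(z a).
rewrite -lee_fin; have <- := cvg_lim _ uc => //.
apply: lime_ge; first by apply/cvg_ex; exists 0%:E.
near=> N; have aN : (deg a <= N)%N by near: N; exact: nbhs_infty_ge.
pose a' : {ffun idx9 -> 'I_N.+1} := [ffun p => inord (a p)].
have a'E : (fun p => a' p : nat) = a.
  by apply/funext => p; rewrite ffunE inordK// ltnS (leq_trans (leq_deg a p)).
pose S (r : multiindex -> R) x :=
  \sum_(b : {ffun idx9 -> 'I_N.+1} | (deg (fun p => b p) <= N)%N) r (fun p => b p) * hermite9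
    (fun p => b p) x.
have sS r : sqint (mu9 R) (S r) by apply: sqint_sum => b; exact: sqint_hermite9.
have iS r : inner (mu9 R) (S r) (hermite9 a) = r a.
  rewrite inner_sum//; [|by move=> b; exact: sqint_hermite9|exact: sqint_hermite9].
  rewrite (bigD1 a')/= ?a'E// big1 => [|b /andP[_ ba]].
    by rewrite -a'E e_orth eqxx !mulr1 addr0.
  have -> : @hermite9 R a = hermite9 (fun p => a' p) by rewrite a'E.
  by rewrite e_orth (negbTE ba) mul0r mulr0.
pose D x := u t x - evolution_sum N f t x.
have DRe : (fun x => Re (D x)) = (fun x => Re (u t x) + (-1) * S (Re \o z) x).
  apply/funext => x; rewrite raddfB/= Re_sum mulN1r; congr (_ - _).
  by apply: eq_bigr => b _; exact: Re_mul_real.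
have DIm : (fun x => Im (D x)) = (fun x => Im (u t x) + (-1) * S (Im \o z) x).
  apply/funext => x; rewrite raddfB/= Im_sum mulN1r; congr (_ - _).
  by apply: eq_bigr => b _; exact: Im_mul_real.
have sDr : sqint (mu9 R) (fun x => Re (D x)) by rewrite DRe; apply: sqintD => //; exact: sqintZ.
have sDi : sqint (mu9 R) (fun x => Im (D x)) by rewrite DIm; apply: sqintD => //; exact: sqintZ.
have iD h r : sqint (mu9 R) h -> inner (mu9 R) (fun x => h x + (-1) * S r x) (hermite9 a)
    = inner (mu9 R) h (hermite9 a) - r a.
  move=> sh; rewrite -(iS r) /inner -(@RintegralB _ _ _ (mu9 R))//.
  - by apply: eq_Rintegral => x _; rewrite mulrDl mulN1r mulNr.
  - by apply: sqint_integrableM => //; exact: sqint_hermite9.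
  - by apply: sqint_integrableM => //; exact: sqint_hermite9.
(* Cauchy-Schwarz against a unit vector, as Bessel's inequality for a family with one member. *)
have B h : sqint (mu9 R) h -> inner (mu9 R) h (hermite9 a) ^+ 2 <= inner (mu9 R) h h.
  move=> sh; rewrite -[leRHS]mul1r.
  have := @bessel _ _ _ (mu9 R) unit xpredT (fun=> hermite9 a) 1 h ltr01.
  rewrite big_const card_unit/= addr0; apply => //; first by move=> _; exact: sqint_hermite9.
  have aa : [forall p, a p == a p] by apply/forallP.
  by move=> [] []; rewrite hermite9_orthonormal aa mulr1.
rewrite /sqnormL2 (@sqint_sqmod _ _ (mu9 R) D)// lee_fin.
apply: le_trans (lerD (B _ sDr) (B _ sDi)).
by rewrite DRe DIm !iD// /sqmod !raddfB Re_coef Im_coef.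
Unshelve. all: by end_near.
Qed.

End HermiteCoefficients.

(** * Orthogonality in time *)

Section TimeIntegral.
Variable R : realType.
Implicit Types (w t : R) (n p q : nat).
Let leb := @lebesgue_measure R.

Definition period : set (measurableTypeR R) := `[0, 2 * pi]%classic.

Lemma measurable_period : measurable period.
Proof. exact: measurable_itv. Qed.

(** [e^(2 pi i w) = 1]. Stated through sine and cosine, it passes to sums and opposites, hence from
    naturals to differences of frequencies. *)
Definition full_turn w := sin (2 * pi * w) = 0 /\ cos (2 * pi * w) = 1.

Lemma full_turnD w1 w2 : full_turn w1 -> full_turn w2 -> full_turn (w1 + w2).
Proof.
by move=> [s1 c1] [s2 c2]; rewrite /full_turn mulrDr sinD cosD s1 c1 s2 c2; split; ring.
Qed.

Lemma full_turnN w : full_turn w -> full_turn (- w).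
Proof. by move=> [s c]; rewrite /full_turn mulrN sinN cosN s c oppr0. Qed.

Lemma full_turn_nat n : full_turn n%:R.
Proof.
elim: n => [|n IH]; first by rewrite /full_turn mulr0 sin0 cos0.
by rewrite -natr1; apply: full_turnD => //; rewrite /full_turn mulr1 mulr_natl sin2pi cos2pi.
Qed.

Lemma continuous_cos_scale w : continuous (fun t => cos (t * w)).
Proof.
by move=> t; apply: (@continuous_comp _ _ _ (fun t => t * w));
  [exact: mulrr_continuous|exact: continuous_cos].
Qed.

Lemma continuous_sin_scale w : continuous (fun t => sin (t * w)).
Proof.
by move=> t; apply: (@continuous_comp _ _ _ (fun t => t * w));
  [exact: mulrr_continuous|exact: continuous_sin].
Qed.

Lemma FTC_period (f F : R -> R) : continuous f -> (forall t, is_derive t (1 : R) F (f t)) ->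
  Rintegral leb period f = F (2 * pi) - F 0.
Proof.
move=> cf dF.
have cF : continuous F.
  move=> t; apply: differentiable_continuous; apply/derivable1_diffP.
  exact: (@ex_derive _ _ _ _ _ _ _ (dF t)).
have p0 : (0 : R) < 2 * pi by rewrite mulr_gt0// pi_gt0.
rewrite /Rintegral (@continuous_FTC2 _ f F)//.
- exact: continuous_subspaceT.
- split.
  + by move=> t _; exact: (@ex_derive _ _ _ _ _ _ _ (dF t)).
  + by apply: cvg_at_right_filter; exact: cF.
  + by apply: cvg_at_left_filter; exact: cF.
- by move=> t _; rewrite derive1E; exact: (@derive_val _ _ _ _ _ _ _ (dF t)).
Qed.

Lemma integral_cos w : full_turn w ->
  Rintegral leb period (fun t => cos (t * w)) = (w == 0)%:R * (2 * pi).
Proof.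
move=> [s c]; have [->|w0] := eqVneq w 0.
  have dF t : is_derive t (1 : R) id (cos (t * 0)) by rewrite mulr0 cos0; exact: is_derive_id.
  by rewrite mul1r (FTC_period (@continuous_cos_scale 0) dF) subr0.
have dF t : is_derive t (1 : R) (fun t => w^-1 * sin (t * w)) (cos (t * w)).
  rewrite (_ : (fun t => _) = (w^-1 \*o (sin \o (id * cst w)))); last by apply/funext.
  apply: is_derive_eq; rewrite /GRing.scale /=.
  by rewrite (_ : (id * cst w) t = t * w)//; field.
by rewrite mul0r (FTC_period (@continuous_cos_scale w) dF) s mul0r sin0 subrr.
Qed.

Lemma integral_sin w : full_turn w -> Rintegral leb period (fun t => sin (t * w)) = 0.
Proof.
move=> [s c]; have [->|w0] := eqVneq w 0.
  have dF t : is_derive t (1 : R) (cst 0) (sin (t * 0)) by rewrite mulr0 sin0;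
    exact: is_derive_cst.
  by rewrite (FTC_period (@continuous_sin_scale 0) dF) subrr.
have dF t : is_derive t (1 : R) (fun t => - w^-1 * cos (t * w)) (sin (t * w)).
  rewrite (_ : (fun t => _) = ((- w^-1) \*o (cos \o (id * cst w)))); last by apply/funext.
  apply: is_derive_eq; rewrite /GRing.scale /=.
  by rewrite (_ : (id * cst w) t = t * w)//; field.
by rewrite (FTC_period (@continuous_sin_scale w) dF) c mul0r cos0 subrr.
Qed.

Lemma integrable_period (f : R -> R) : continuous f -> leb.-integrable period (EFin \o f).
Proof.
move=> cf; apply: continuous_compact_integrable; first exact: segment_compact.
exact: continuous_subspaceT.
Qed.

Definition freq (k : nat) : R := (2 * k + 9)%N%:R.

(* Cut off outside [0, 2 pi], so that space-time integrals are over a full product. *)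
Definition wave (s : bool) (k : nat) : R -> R :=
  (fun t => if s then cos (t * freq k) else sin (t * freq k)) \_ period.

Lemma measurable_wave s k : measurable_fun [set: measurableTypeR R] (wave s k).
Proof.
apply/(measurable_restrictT _ measurable_period); apply: measurable_funTS.
apply: measurable_realfun.continuous_measurable_fun.
case: s; [exact: continuous_cos_scale|exact: continuous_sin_scale].
Qed.

Lemma freq_diff p q : full_turn (freq p - freq q) /\ full_turn (freq p + freq q).
Proof.
by split; apply: full_turnD; try apply: full_turnN; exact: full_turn_nat.
Qed.

(** Product-to-sum formulas leave the frequencies [freq p - freq q], zero only for [p = q], and
    [freq p + freq q], never zero; only a cosine of frequency zero has a nonzero integral. *)
Lemma inner_wave s s' p q :
  inner leb (wave s p) (wave s' q) = ((s, p) == (s', q))%:R * pi.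
Proof.
have [tm tp] := freq_diff p q.
have -> : inner leb (wave s p) (wave s' q) = Rintegral leb period (fun t =>
    (if s then cos (t * freq p) else sin (t * freq p)) *
    (if s' then cos (t * freq q) else sin (t * freq q))).
  rewrite Rintegral_mkcond; apply: eq_Rintegral => t _; rewrite /wave !patchE.
  by case: ifP => //; rewrite mul0r.
have eq0 : (freq p - freq q == 0) = (p == q).
  by rewrite subr_eq0 eqr_nat eqn_add2r eqn_pmul2l.
have ne0 : (freq p + freq q == 0) = false.
  by rewrite -natrD pnatr_eq0 !addnS.
pose c w t : R := cos (t * w); pose d w t : R := sin (t * w).
have ic w : leb.-integrable period (EFin \o c w).
  by apply: integrable_period; exact: continuous_cos_scale.
have id_ w : leb.-integrable period (EFin \o d w).
  by apply: integrable_period; exact: continuous_sin_scale.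
have half (f g h : R -> R) : leb.-integrable period (EFin \o f) -> leb.-integrable period
  (EFin \o g) ->
    (forall t, h t = 2^-1 * (f t + g t)) ->
    Rintegral leb period h = 2^-1 * (Rintegral leb period f + Rintegral leb period g).
  move=> fi gi hE; rewrite -(@RintegralD _ _ _ leb)//; last exact: measurable_period.
  rewrite -(@RintegralZl _ _ _ leb)//; [|exact: measurable_period|].
    by apply: eq_Rintegral => t _; rewrite hE.
  rewrite (_ : EFin \o _ = (fun t => (EFin \o f) t + (EFin \o g) t)%E)//.
  by apply: integrableD => //; exact: measurable_period.
have nint w : leb.-integrable period (EFin \o (fun t => - c w t)).
  rewrite (_ : EFin \o _ = (-%E \o (EFin \o c w)))//.
  by apply: integrableN => //; exact: measurable_period.
rewrite xpair_eqE; case: s; case: s' => /=.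
- rewrite (half (c (freq p - freq q)) (c (freq p + freq q)))//; last first.
    by move=> t; rewrite /c [t * (_ - _)]mulrBr [t * (_ + _)]mulrDr cosB cosD; field.
  by rewrite !integral_cos// eq0 ne0; case: (p == q) => /=; rewrite ?mul0r ?mul1r; field.
- rewrite (half (d (freq p + freq q)) (d (freq q - freq p)))//; last first.
    by move=> t; rewrite /d [t * (_ - _)]mulrBr [t * (_ + _)]mulrDr sinB sinD; field.
  rewrite !integral_sin//; first by rewrite addr0 mulr0 mul0r.
  by rewrite -opprB; exact: full_turnN.
- rewrite (half (d (freq p + freq q)) (d (freq p - freq q)))//; last first.
    by move=> t; rewrite /d [t * (_ - _)]mulrBr [t * (_ + _)]mulrDr sinB sinD; field.
  by rewrite !integral_sin// addr0 mulr0 mul0r.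
- rewrite (half (c (freq p - freq q)) (fun t => - c (freq p + freq q) t))//; last first.
    by move=> t; rewrite /c [t * (_ - _)]mulrBr [t * (_ + _)]mulrDr cosB cosD; field.
  have -> : Rintegral leb period (fun t => - c (freq p + freq q) t) = - Rintegral leb period
    (c (freq p + freq q)).
    rewrite -mulN1r -(@RintegralZl _ _ _ leb)//; [|exact: measurable_period|exact: ic].
    by apply: eq_Rintegral => t _; rewrite mulN1r.
  by rewrite !integral_cos// eq0 ne0; case: (p == q) => /=; rewrite ?mul0r ?mul1r; field.
Qed.

Lemma sqint_wave s k : sqint leb (wave s k).
Proof.
split; first exact: measurable_wave.
have c1 : continuous (cst 1 : R -> R) by move=> t; exact: cvg_cst.
have := integrable_lty measurable_period (integrable_period c1).
apply: le_lt_trans; rewrite [leRHS]integral_mkcond; apply: ge0_le_integral => //.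
- by move=> t _; rewrite lee_fin sqr_ge0.
- by apply/measurable_EFinP; apply: measurable_funX; exact: measurable_wave.
- by apply/(measurable_restrictT _ measurable_period); apply/measurable_EFinP;
  exact: measurable_cst.
- move=> t _; rewrite /wave !patchE; case: ifP => _ /=; last by rewrite expr0n.
  rewrite lee_fin; case: s.
    by have := cos2Dsin2 (t * freq k); have := sqr_ge0 (sin (t * freq k)); lra.
  by have := cos2Dsin2 (t * freq k); have := sqr_ge0 (cos (t * freq k)); lra.
Qed.

Lemma time_parseval m n (a b : nat -> R) :
  inner leb (fun t => \sum_(m <= k < n) (a k * wave true k t + b k * wave false k t))
            (fun t => \sum_(m <= k < n) (a k * wave true k t + b k * wave false k t)) =
  pi * \sum_(m <= k < n) (a k ^+ 2 + b k ^+ 2).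
Proof.
pose P (k : 'I_n) := (m <= k)%N.
pose c (i : bool * 'I_n) := if i.1 then a i.2 else b i.2.
pose e (i : bool * 'I_n) := wave i.1 i.2.
have se i : sqint leb (e i) by exact: sqint_wave.
have oe i j : inner leb (e i) (e j) = (i == j)%:R * pi.
  by case: i j => [s k] [s' k']; rewrite inner_wave.
have sum2 (f : bool * 'I_n -> R) : \sum_(i | P i.2) f i = \sum_(k | P k)
  (f (true, k) + f (false, k)).
  transitivity (\sum_(i : bool * 'I_n | xpredT i.1 && P i.2) f (i.1, i.2)).
    by apply: eq_big => // -[].
  by rewrite -(pair_big xpredT P (fun s k => f (s, k)))/= big_bool/= -big_split.
have := parseval (fun i : bool * 'I_n => P i.2) c se oe.
rewrite sum2 /= big_geq_mkord => <-; rewrite /inner.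
by apply: eq_Rintegral => t _; rewrite sum2 /= big_geq_mkord.
Qed.

End TimeIntegral.

Section SpacetimeWaves.
Variable R : realType.
Let leb := @lebesgue_measure R.
Let spacetime := (leb \x mu3 R)%E.
Variables A B : nat -> R3 R -> R.
Hypothesis sA : forall k, sqint (mu3 R) (A k).
Hypothesis sB : forall k, sqint (mu3 R) (B k).

(** The real part of the sum of [(A_k + i B_k) e^(-i t freq k)]; the imaginary part is obtained by
    replacing [(A, B)] with [(B, -A)]. *)
Definition spacetime_wave m n (q : R * R3 R) : R :=
  \sum_(m <= k < n) (A k q.2 * wave true k q.1 + B k q.2 * wave false k q.1).

Lemma measurable_spacetime_wave m n :
  measurable_fun [set: meas_spacetime R] (spacetime_wave m n).
Proof.
have mw s k : measurable_fun [set: meas_spacetime R] (fun q : R * R3 R => wave s k q.1).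
  by apply: measurableT_comp; [exact: measurable_wave|exact: measurable_fst].
have mA k : measurable_fun [set: meas_spacetime R] (fun q : R * R3 R => A k q.2).
  by apply: measurableT_comp; [exact: (sA k).1|exact: measurable_snd].
have mB k : measurable_fun [set: meas_spacetime R] (fun q : R * R3 R => B k q.2).
  by apply: measurableT_comp; [exact: (sB k).1|exact: measurable_snd].
apply: measurable_sum => k.
by apply: measurable_funD; apply: measurable_funM.
Qed.

(** Time is integrated first: at each fixed point [x] the cross terms vanish by orthogonality of the
    waves, whatever the spatial profiles. *)
Lemma spacetime_wave_norm m n :
  (\int[spacetime]_q (spacetime_wave m n q ^+ 2)%:E =
   (pi * \sum_(m <= k < n) (inner (mu3 R) (A k) (A k) + inner (mu3 R) (B k) (B k)))%:E)%E.
Proof.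
have mf : measurable_fun [set: meas_spacetime R] (fun q => (spacetime_wave m n q ^+ 2)%:E).
  by apply/measurable_EFinP; apply: measurable_funX; exact: measurable_spacetime_wave.
rewrite /spacetime fubini_tonelli2//; last by move=> q; rewrite lee_fin sqr_ge0.
rewrite /fubini_G.
have E x : (\int[leb]_t (spacetime_wave m n (t, x) ^+ 2)%:E =
    (pi * \sum_(m <= k < n) (A k x ^+ 2 + B k x ^+ 2))%:E)%E.
  rewrite -(time_parseval m n (fun k => A k x) (fun k => B k x)).
  apply: inner_integral; rewrite /spacetime_wave /=.
  rewrite (_ : (fun t => _) = fun t => \sum_(m <= k < n) A k x * wave true k t
    + \sum_(m <= k < n) B k x * wave false k t); last by apply/funext => t; rewrite big_split.
  by apply: sqintD; apply: sqint_sum => k; exact: sqint_wave.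
under eq_integral do rewrite E EFinM -sumEFin.
have mAB k : measurable_fun [set: meas3 R] (fun x => (A k x ^+ 2 + B k x ^+ 2)%:E).
  by apply/measurable_EFinP; apply: measurable_funD; apply: measurable_funX;
    [exact: (sA k).1|exact: (sB k).1].
rewrite ge0_integralZl//.
- rewrite ge0_integral_sum//; last by move=> k x _; rewrite lee_fin addr_ge0 ?sqr_ge0.
  rewrite EFinM -sumEFin; congr (_ * _)%E; apply: eq_bigr => k _.
  rewrite EFinD -!inner_integral// -ge0_integralD//.
  + by move=> x _; rewrite lee_fin sqr_ge0.
  + by apply/measurable_EFinP; apply: measurable_funX; exact: (sA k).1.
  + by move=> x _; rewrite lee_fin sqr_ge0.
  + by apply/measurable_EFinP; apply: measurable_funX; exact: (sB k).1.
- by apply: emeasurable_sum => k; exact: mAB.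
- by move=> x _; apply: sume_ge0 => k _; rewrite lee_fin addr_ge0 ?sqr_ge0.
- by rewrite lee_fin pi_ge0.
Qed.

End SpacetimeWaves.

(** * Space-time norms as integrals over a product measure *)

Section SpacetimeNorm.
Variable R : realType.
Let leb := @lebesgue_measure R.

Lemma sqnorm_spacetimeE (w : R -> R3 R -> R[i]) (h : R * R3 R -> R) :
  measurable_fun [set: meas_spacetime R] h ->
  (forall t x, t \in @period R -> h (t, x) = sqmod (w t x)) ->
  (forall t x, t \notin @period R -> h (t, x) = 0) ->
  sqnorm_spacetime w = (\int[(leb \x mu3 R)%E]_q (h q)%:E)%E.
Proof.
move=> mh hin hout.
have h0 q : (0 <= (h q)%:E)%E.
  case: q => t x; rewrite lee_fin; have [tD|tD] := boolP (t \in @period R).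
    by rewrite hin// sqmod_ge0.
  by rewrite hout.
have mE : measurable_fun [set: meas_spacetime R] (EFin \o h) by exact/measurable_EFinP.
rewrite (@fubini_tonelli1 _ _ _ _ _ leb (mu3 R) (EFin \o h) mE h0).
rewrite /sqnorm_spacetime integral_mkcond; apply: eq_integral => t _.
rewrite patchE /fubini_F -/(@period R); case: ifPn => tD.
  by apply: eq_integral => x _; rewrite /= hin.
by rewrite integral0_eq// => x _; rewrite /= hout.
Qed.

Lemma measurable_cut (F : R * R3 R -> R) : measurable_fun [set: meas_spacetime R] F ->
  measurable_fun [set: meas_spacetime R] (fun q => F q * \1_(@period R) q.1).
Proof.
move=> mF; apply: measurable_funM => //.
apply: measurableT_comp; last exact: measurable_fst.
by apply: measurable_indic; exact: measurable_period.
Qed.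

Lemma sqnorm_cut (w : R -> R3 R -> R[i]) (F : R * R3 R -> R) :
  measurable_fun [set: meas_spacetime R] F ->
  (forall t x, t \in @period R -> F (t, x) = sqmod (w t x)) ->
  sqnorm_spacetime w = (\int[(leb \x mu3 R)%E]_q (F q * \1_(@period R) q.1)%:E)%E.
Proof.
move=> mF Fw; apply: sqnorm_spacetimeE; first exact: measurable_cut.
  by move=> t x tD; rewrite /= indicE tD mulr1 Fw.
by move=> t x tD; rewrite /= indicE (negbTE tD) mulr0.
Qed.

Lemma sqnorm_cut_le (F : R * R3 R -> R) :
  measurable_fun [set: meas_spacetime R] F -> (forall q, 0 <= F q) ->
  (\int[(leb \x mu3 R)%E]_q (F q * \1_(@period R) q.1)%:E <= \int[(leb \x mu3 R)%E]_q (F q)%:E)%E.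
Proof.
move=> mF F0; apply: ge0_le_integral.
- exact: measurableT.
- by move=> q _; rewrite lee_fin mulr_ge0.
- by apply/measurable_EFinP; exact: measurable_cut.
- exact/measurable_EFinP.
- by move=> q _; rewrite lee_fin indicE ler_piMr// lern1 leq_b1.
Qed.

End SpacetimeNorm.

(** [tau] is the sequence of tails; it becomes the rate in [riesz_fischer]. *)
Lemma series_tail (R : realType) (rho : nat -> R) (L : R) :
  (forall k, 0 <= rho k) -> (forall n, \sum_(0 <= k < n) rho k <= L) ->
  exists tau : nat -> R, (tau @ \oo --> (0 : R))%classic /\
    forall m n, (m <= n)%N -> \sum_(m <= k < n) rho k <= tau m.
Proof.
move=> rho0 rhoL; pose r n := \sum_(0 <= k < n) rho k.
have rmono : {homo r : m n / (m <= n)%N >-> m <= n}.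
  by apply: nondecreasing_series => k _ _; exact: rho0.
have rc : cvgn r.
  by apply: nondecreasing_is_cvgn => //; exists L => _ [n _ <-]; exact: rhoL.
exists (fun m => limn r - r m); split.
  by rewrite -[X in (_ --> X)%classic](subrr (limn r)); apply: cvgB => //; exact: cvg_cst.
move=> m n mn; have -> : \sum_(m <= k < n) rho k = r n - r m.
  have -> : r n = r m + \sum_(m <= k < n) rho k by rewrite /r -big_cat_nat.
  by rewrite addrAC subrr add0r.
by rewrite lerD2r; exact: nondecreasing_cvgn_le.
Qed.

(** * The estimate *)

Section DiagonalWave.
Variables (R : realType) (f g : R9 R -> R[i]) (u : R -> R9 R -> R[i]).
Hypotheses (f2 : inL2 f) (g2 : inL2 g) (fg : weak_hermite_op f g)
  (fu : schrodinger_solution f u).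
Let leb := @lebesgue_measure R.
Let spacetime := (leb \x mu3 R)%E.

Let cRe a := complex.Re (hermite_coef f a).
Let cIm a := complex.Im (hermite_coef f a).
Let A k := diag_slice k cRe.
Let B k := diag_slice k cIm.
Let A' k := diag_slice k (fun a => - cRe a).

Let dc0 : 0 <= diag_const R. Proof. exact/ltW/diag_const_gt0. Qed.

Let rho k := diag_const R * deg_slice k (fun a => sqmod (hermite_coef g a)).

(** The factor [(k+1)^2] of [diagonal_bound] is absorbed by the eigenvalue [(2k+9)^2]. General [c]
    and [d] serve both the pair of the real part and that of the imaginary part. *)
Let slice_le (c d : multiindex -> R) k : (forall a, c a ^+ 2 + d a ^+ 2 = sqmod
  (hermite_coef f a)) ->
  inner (mu3 R) (diag_slice k c) (diag_slice k c) + inner (mu3 R) (diag_slice k d)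
    (diag_slice k d) <= rho k.
Proof.
move=> cd; apply: le_trans (lerD (diagonal_bound k c) (diagonal_bound k d)) _.
rewrite -mulrDr /rho -mulrA ler_wpM2l//.
rewrite /deg_slice -big_split/= mulr_sumr; apply: ler_sum => a /eqP da.
rewrite cd (sqmod_coef_weak _ f2 fg) ler_wpM2r ?sqmod_ge0//.
apply: lerXn2r; rewrite ?nnegrE ?ler0n// /eigenvalue9 ler_nat da.
by lia.
Qed.

Let rho_ge0 k : 0 <= rho k.
Proof.
by rewrite mulr_ge0//; apply: sumr_ge0 => a _; exact: sqmod_ge0.
Qed.

Let rho_sum n : ((\sum_(0 <= k < n) rho k)%:E <= (diag_const R)%:E * sqnormL2 g)%E.
Proof.
rewrite -mulr_sumr big_mkord EFinM lee_wpmul2l ?lee_fin//.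
exact: bessel_coef.
Qed.

Let X := spacetime_wave A B.
Let Y := spacetime_wave B A'.

Let sA k : sqint (mu3 R) (A k). Proof. exact: sqint_diag_slice. Qed.
Let sB k : sqint (mu3 R) (B k). Proof. exact: sqint_diag_slice. Qed.
Let sA' k : sqint (mu3 R) (A' k). Proof. exact: sqint_diag_slice. Qed.

Let mX m n : measurable_fun [set: meas_spacetime R] (X m n).
Proof. exact: (measurable_spacetime_wave sA sB m n). Qed.
Let mY m n : measurable_fun [set: meas_spacetime R] (Y m n).
Proof. exact: (measurable_spacetime_wave sB sA' m n). Qed.

Let X_norm m n : (\int[spacetime]_q (X m n q ^+ 2)%:E <= (pi * \sum_(m <= k < n) rho k)%:E)%E.
Proof.
have -> := spacetime_wave_norm sA sB m n; rewrite lee_fin ler_wpM2l ?pi_ge0//.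
by apply: ler_sum => k _; exact: slice_le.
Qed.

Let Y_norm m n : (\int[spacetime]_q (Y m n q ^+ 2)%:E <= (pi * \sum_(m <= k < n) rho k)%:E)%E.
Proof.
have -> := spacetime_wave_norm sB sA' m n; rewrite lee_fin ler_wpM2l ?pi_ge0//.
by apply: ler_sum => k _; apply: slice_le => a; rewrite sqrrN addrC.
Qed.

(** By [coef_solution] each slice is [(A_k + i B_k) e^(-i t (2k+9))]; on the period the cut-off
    waves are the true cosine and sine. *)
Let hermite_sum_diag N t x : t \in @period R ->
  hermite_sum N (u t) (diag9 x) = ((X 0 N.+1 (t, x)) +i* (Y 0 N.+1 (t, x)))%C.
Proof.
move=> tD.
have wt k : wave true k t = cos (t * freq R k) by rewrite /wave patchE tD.
have wf k : wave false k t = sin (t * freq R k) by rewrite /wave patchE tD.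
pose FRe a := complex.Re (expNi (t * eigenvalue9 R a) * hermite_coef f a) * hermite9 a (diag9 x).
pose FIm a := complex.Im (expNi (t * eigenvalue9 R a) * hermite_coef f a) * hermite9 a (diag9 x).
have ReE : complex.Re (hermite_sum N (u t) (diag9 x)) = X 0 N.+1 (t, x).
  transitivity (\sum_(a : {ffun idx9 -> 'I_N.+1} | (deg (fun p => a p) <= N)%N)
      FRe (fun p => a p)).
    by rewrite Re_sum; apply: eq_bigr => a _; rewrite /FRe -(coef_solution _ _ f2 fu);
      exact: Re_mul_real.
  rewrite sum_deg_slice.
  rewrite /X /spacetime_wave big_mkord; apply: eq_bigr => k _.
  rewrite wt wf /A /B /diag_slice /deg_slice !mulr_suml -big_split; apply: eq_bigr => a /eqP da.
  rewrite /FRe /FIm /eigenvalue9 da /cRe /cIm; case: (hermite_coef f _) => r i /=; rewrite /freq;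
    ring.
have ImE : complex.Im (hermite_sum N (u t) (diag9 x)) = Y 0 N.+1 (t, x).
  transitivity (\sum_(a : {ffun idx9 -> 'I_N.+1} | (deg (fun p => a p) <= N)%N)
      FIm (fun p => a p)).
    by rewrite Im_sum; apply: eq_bigr => a _; rewrite /FIm -(coef_solution _ _ f2 fu);
      exact: Im_mul_real.
  rewrite sum_deg_slice.
  rewrite /Y /spacetime_wave big_mkord; apply: eq_bigr => k _.
  rewrite wt wf /A' /B /diag_slice /deg_slice !mulr_suml -big_split; apply: eq_bigr => a /eqP da.
  rewrite /FRe /FIm /eigenvalue9 da /cRe /cIm; case: (hermite_coef f _) => r i /=; rewrite /freq;
    ring.
by rewrite -ReE -ImE; case: (hermite_sum _ _ _).
Qed.

Let sum_cut (F : nat -> R) m n : (m <= n)%N ->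
  \sum_(0 <= k < n) F k - \sum_(0 <= k < m) F k = \sum_(m <= k < n) F k.
Proof. by move=> mn; rewrite (big_cat_nat (n := m) (m := 0%N))//= addrAC subrr add0r. Qed.

(** [X] and [Y] are Cauchy in space-time because their increments are controlled by the tails of the
    convergent series of [rho]; Riesz-Fischer supplies the two parts of [v]. *)
Lemma diagonal_restriction_exists : exists v, diagonal_restriction u v.
Proof.
have gfin : sqnormL2 g \is a fin_num by rewrite sqnormL2E.
have [|tau [tau0 tauP]] := series_tail rho_ge0 (L := diag_const R * fine (sqnormL2 g)).
  by move=> n; rewrite -lee_fin EFinM fineK// rho_sum.
have ptau0 : ((fun m => pi * tau m) @ \oo --> (0 : R))%classic.
  by rewrite -(mulr0 pi); apply: cvgMr.
have [|vX [mvX vXP]] := @riesz_fischer _ (meas_spacetime R) R spacetime (X 0) _ (mX 0) ptau0.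
  move=> m n mn; under eq_integral do rewrite sum_cut//.
  apply: le_trans (X_norm m n) _; rewrite lee_fin ler_wpM2l ?pi_ge0//; exact: tauP.
have [|vY [mvY vYP]] := @riesz_fischer _ (meas_spacetime R) R spacetime (Y 0) _ (mY 0) ptau0.
  move=> m n mn; under eq_integral do rewrite sum_cut//.
  apply: le_trans (Y_norm m n) _; rewrite lee_fin ler_wpM2l ?pi_ge0//; exact: tauP.
exists (fun t x => (vX (t, x) +i* vY (t, x))%C); split.
  by split => /=; [rewrite (_ : (fun q => _) = vX)|rewrite (_ : (fun q => _) = vY)] => //;
    apply/funext => -[].
(* Degrees up to [N] make [N+1] slices, whence [tau N.+1]; the factor 2 counts the real and the
   imaginary part. *)
have bound N : (sqnorm_spacetime (fun t x => hermite_sum N (u t) (diag9 x) -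
  (vX (t, x) +i* vY (t, x))%C)%R
    <= (2 * (pi * tau N.+1))%:E)%E.
  have mF1 : measurable_fun [set: meas_spacetime R] (fun q => (X 0 N.+1 q - vX q) ^+ 2).
    by apply: measurable_funX; apply: measurable_funB; [exact: mX|exact: mvX].
  have mF2 : measurable_fun [set: meas_spacetime R] (fun q => (Y 0 N.+1 q - vY q) ^+ 2).
    by apply: measurable_funX; apply: measurable_funB; [exact: mY|exact: mvY].
  have mF := measurable_funD mF1 mF2.
  rewrite (sqnorm_cut mF); last first.
    by move=> t x tD; rewrite hermite_sum_diag.
  apply: le_trans (sqnorm_cut_le mF _) _; first by move=> q; rewrite addr_ge0 ?sqr_ge0.
  rewrite mulr_natl mulr2n EFinD; apply: le_trans (leeD (vXP N.+1) (vYP N.+1)).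
  rewrite -ge0_integralD//.
  - by move=> q _; rewrite lee_fin sqr_ge0.
  - exact/measurable_EFinP.
  - by move=> q _; rewrite lee_fin sqr_ge0.
  - exact/measurable_EFinP.
apply: (@squeeze_cvge _ _ _ _ (cst 0%E) _ (fun N => (2 * (pi * tau N.+1))%:E)).
- apply: nearW => N; rewrite bound andbT; apply: integral_ge0 => t _.
  by apply: integral_ge0 => x _; rewrite lee_fin sqmod_ge0.
- exact: cvg_cst.
- apply: cvg_EFin; first exact: nearW.
  rewrite -(mulr0 2); apply: cvgMr.
  by have := ptau0; rewrite -cvg_shiftS.
Qed.

(** The partial sums satisfy the bound with [2 pi diag_const], and
    [|v|^2 <= 2 |S_N - v|^2 + 2 |S_N|^2] transfers it to their limit at the price of a factor 2,
    whence [4 pi diag_const]. *)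
Lemma diagonal_restriction_bound v : diagonal_restriction u v ->
  (sqnorm_spacetime v <= (4 * pi * diag_const R)%:E * sqnormL2 g)%E.
Proof.
move=> [[mvr mvi] vc].
have gfin : sqnormL2 g \is a fin_num by rewrite sqnormL2E.
set c := (4 * pi * diag_const R)%:E.
pose s N := sqnorm_spacetime (fun t x => hermite_sum N (u t) (diag9 x) - v t x).
have bound N : (sqnorm_spacetime v <= 2%:E * s N + c * sqnormL2 g)%E.
  pose F1 (q : R * R3 R) := sqmod (v q.1 q.2).
  pose F2 (q : R * R3 R) := (X 0 N.+1 q - complex.Re (v q.1 q.2)) ^+ 2 +
    (Y 0 N.+1 q - complex.Im (v q.1 q.2)) ^+ 2.
  pose F3 q := X 0 N.+1 q ^+ 2 + Y 0 N.+1 q ^+ 2.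
  have mX2 : measurable_fun [set: meas_spacetime R] (fun q => X 0 N.+1 q ^+ 2).
    by apply: measurable_funX; exact: mX.
  have mY2 : measurable_fun [set: meas_spacetime R] (fun q => Y 0 N.+1 q ^+ 2).
    by apply: measurable_funX; exact: mY.
  have mF1 : measurable_fun [set: meas_spacetime R] F1.
    by apply: measurable_funD; apply: measurable_funX.
  have mF2 : measurable_fun [set: meas_spacetime R] F2.
    by apply: measurable_funD; apply: measurable_funX; apply: measurable_funB.
  have mF3 : measurable_fun [set: meas_spacetime R] F3 by exact: measurable_funD.
  have F20 q : 0 <= F2 q by rewrite addr_ge0 ?sqr_ge0.
  have F30 q : 0 <= F3 q by rewrite addr_ge0 ?sqr_ge0.
  have F3le : (\int[spacetime]_q (F3 q)%:E <= (2 * pi * diag_const R)%:E * sqnormL2 g)%E.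
    rewrite (_ : \int[spacetime]_q (F3 q)%:E = \int[spacetime]_q (X 0 N.+1 q ^+ 2)%:E +
      \int[spacetime]_q (Y 0 N.+1 q ^+ 2)%:E)%E; last first.
      rewrite -ge0_integralD//.
      - by move=> q _; rewrite lee_fin sqr_ge0.
      - by apply/measurable_EFinP; exact: mX2.
      - by move=> q _; rewrite lee_fin sqr_ge0.
      - by apply/measurable_EFinP; exact: mY2.
    apply: le_trans (leeD (X_norm _ _) (Y_norm _ _)) _.
    have -> : ((2 * pi * diag_const R)%:E * sqnormL2 g = (2 * pi)%:E *
      ((diag_const R)%:E * sqnormL2 g))%E.
      by rewrite muleA -EFinM.
    rewrite -EFinD (_ : pi * _ + _ = 2 * pi * \sum_(0 <= k < N.+1) rho k); last by ring.
    rewrite [leLHS]EFinM.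
    by apply: lee_wpmul2l; rewrite ?rho_sum// lee_fin mulr_ge0 ?pi_ge0.
  have sv : sqnorm_spacetime v = (\int[spacetime]_q (F1 q * \1_(@period R) q.1)%:E)%E.
    exact: sqnorm_cut.
  have ss : s N = (\int[spacetime]_q (F2 q * \1_(@period R) q.1)%:E)%E.
    apply: sqnorm_cut => // t x tD; rewrite hermite_sum_diag// /F2 /=.
    by case: (v t x).
  have le3 := sqnorm_cut_le mF3 F30.
  have mE (F : R * R3 R -> R) : measurable_fun [set: meas_spacetime R] F ->
      measurable_fun [set: meas_spacetime R] (fun q => (F q * \1_(@period R) q.1)%:E).
    by move=> mF; apply/measurable_EFinP; exact: measurable_cut.
  have mE2 (F : R * R3 R -> R) : measurable_fun [set: meas_spacetime R] F ->
      measurable_fun [set: meas_spacetime R] (fun q => 2%:E * (F q * \1_(@period R) q.1)%:E)%E.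
    by move=> mF; apply: measurable_funeM; exact: mE.
  have e0 (F : R * R3 R -> R) q : (forall q, 0 <= F q) -> (0 <= (F q * \1_(@period R) q.1)%:E)%E.
    by move=> F0; rewrite lee_fin mulr_ge0.
  have e02 (F : R * R3 R -> R) q : (forall q, 0 <= F q) ->
    (0 <= 2%:E * (F q * \1_(@period R) q.1)%:E)%E.
    by move=> F0; apply: mule_ge0 => //; exact: e0.
  rewrite sv; apply: (@le_trans _ _ (\int[spacetime]_q
      (2%:E * (F2 q * \1_(@period R) q.1)%:E + 2%:E * (F3 q * \1_(@period R) q.1)%:E))%E).
    apply: ge0_le_integral.
    - exact: measurableT.
    - by move=> q _; apply: e0 => z; exact: sqmod_ge0.
    - exact: mE.
    - by apply: emeasurable_funD; apply: mE2.
    - move=> q _; rewrite -!EFinM -EFinD lee_fin !mulrA -mulrDl ler_wpM2r//.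
      rewrite /F1 /F2 /F3 /sqmod.
      (* [2 (X - a)^2 + 2 X^2 - a^2 = (2 X - a)^2], for each of the two parts. *)
      have := sqr_ge0 (2 * X 0 N.+1 q - complex.Re (v q.1 q.2)).
      have := sqr_ge0 (2 * Y 0 N.+1 q - complex.Im (v q.1 q.2)).
      nra.
  rewrite ge0_integralD//; last 4 first.
  - by move=> q _; exact: e02.
  - exact: mE2.
  - by move=> q _; exact: e02.
  - exact: mE2.
  rewrite !ge0_integralZl//; try (by move=> q _; exact: e0); try exact: mE.
  rewrite -ss leeD2l// /c.
  have -> : ((4 * pi * diag_const R)%:E * sqnormL2 g = 2%:E *
    ((2 * pi * diag_const R)%:E * sqnormL2 g))%E.
    by rewrite muleA -EFinM; congr (_%:E * _)%E; ring.
  by apply: lee_wpmul2l => //; apply: le_trans le3 F3le.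
have lim : ((2%:E * s N + c * sqnormL2 g)%E @[N --> \oo] -->
  (2%:E * 0%:E + c * sqnormL2 g)%E)%classic.
  apply: cvgeD; last exact: cvg_cst.
    by rewrite mule0 fin_num_adde_defr.
  by apply: cvgeZl => //.
move: (lim); rewrite mule0 add0e => /cvg_lim <- //.
apply: lime_ge; last exact: nearW.
by apply/cvg_ex; eexists; exact: lim.
Qed.

End DiagonalWave.

(** The existence clause keeps the estimate from being vacuous in [v]. *)
Theorem theorem2 (R : realType) :
  exists C : R, 0 < C /\
    forall (f g : R9 R -> R[i]) (u : R -> R9 R -> R[i]),
      inL2 f -> inL2 g -> weak_hermite_op f g ->
      schrodinger_solution f u ->
      (exists v : R -> R3 R -> R[i], diagonal_restriction u v) /\
      (forall v : R -> R3 R -> R[i], diagonal_restriction u v ->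
         (sqnorm_spacetime v <= C%:E * sqnormL2 g)%E).
Proof.
exists (4 * pi * diag_const R); split.
  by apply: mulr_gt0; [rewrite mulr_gt0 ?pi_gt0|exact: diag_const_gt0].
move=> f g u f2 g2 fg fu; split; first exact: diagonal_restriction_exists f2 g2 fg fu.
by move=> v; exact: diagonal_restriction_bound f2 g2 fg fu v.
Qed.
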